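(* Let $X$ be a compact metrizable space. Then $X$ is reconstructible if and only if $X$ does not have a universal sequence.
   Context: For a topological space $X$, $[Y]$ denotes the homeomorphism class of $Y$, and the deck of $X$ is the set $\mathcal{D}(X)=\{[X\setminus\{x\}] : x\in X\}$. The space $X$ is reconstructible if every topological space $Z$ with $\mathcal{D}(Z)=\mathcal{D}(X)$ is homeomorphic to $X$. A sequence $\langle B_n : n\in\mathbb{N}\rangle$ of subsets of $X$ converges to a point $x$ if for every neighbourhood $U$ of $x$ there is $N\in\mathbb{N}$ such that $B_n\subseteq U$ for all $n\ge N$. A space $X$ has a universal sequence if for each point $x\in X$ there is a sequence $\langle B_n^x : n\in\mathbb{N}\rangle$ of pairwise disjoint non-empty clopen subsets of $X$ converging to $x$, such that $B_n^x$ and $B_n^y$ are homeomorphic for all $x,y\in X$ and all $n\in\mathbb{N}$.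
   Formalization: The formal theorem assumes X is nonempty and does not have exactly two points; the claim fails there: the empty space is reconstructible yet has a universal sequence vacuously, and the two-point discrete space shares its deck with the two-point indiscrete space but has no universal sequence. *)

(* Defs.v *)
From HB Require Import structures.
From mathcomp Require Import all_boot all_order all_algebra.
From mathcomp Require Import all_classical all_reals all_analysis.

Set Implicit Arguments.
Unset Strict Implicit.
Unset Printing Implicit Defensive.

Local Open Scope classical_set_scope.

Definition homeomorphic (X Y : topologicalType) : Prop :=
  exists (f : X -> Y) (g : Y -> X),
    [/\ cancel f g, cancel g f, continuous f & continuous g].

Definition metrizable (R : realType) (X : topologicalType) : Prop :=
  exists M : metricType R, homeomorphic X M.

(* Homeomorphism classes, and sets of them, are predicates in [_ -> Prop]: the
   universe of [set] is too small for [set topologicalType]. *)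
Definition homeo_class (Y : topologicalType) : topologicalType -> Prop :=
  fun Z => homeomorphic Y Z.

(* A set [A : set X] used as a type is [set_type A], which carries the initial
   topology of the inclusion, i.e. the usual subspace topology (the library's
   [subspace A] is instead a topology on all of [X]). *)
Definition deck (X : topologicalType) : (topologicalType -> Prop) -> Prop :=
  fun C => exists x : X, C = homeo_class (~` [set x] : set X).

Definition reconstructible (X : topologicalType) : Prop :=
  forall Z : topologicalType, deck Z = deck X -> homeomorphic Z X.

Definition sets_converge (X : topologicalType) (B : nat -> set X) (x : X) :
    Prop :=
  forall U : set X, nbhs x U -> \forall n \near \oo, B n `<=` U.

Definition has_universal_sequence (X : topologicalType) : Prop :=
  exists B : X -> nat -> set X,
    (forall x, [/\ trivIset [set: nat] (B x),
                   forall n, B x n !=set0,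
                   forall n, clopen (B x n) &
                   sets_converge (B x) x]) /\
    (forall x y n, homeomorphic (B x n) (B y n)).

(* Main.v *)
Require Import Defs.
From mathcomp Require Import all_boot all_order all_algebra.
From mathcomp Require Import all_classical all_reals all_analysis.

(** Why the theorem holds.

    A universal sequence destroys reconstructibility.  Write [b_n] for the
    common homeomorphism type of the sets [B x n].  Since [B y m] lies inside
    [B x n] as soon as [y] is in [B x n] and [m] is large, there is a nested
    sequence [A_0, A_1, ...] of clopen sets of types [b_(n_0), b_(n_1), ...]
    shrinking to a point [p].  For [z <> p] a tail of the sequence at [z]
    provides disjoint clopen sets [C_k], of the same types as the [A_k], which
    converge to [z].  In [X \ {z}] the copy [C_k] of [A_k] splits into copies
    of [A_k \ A_(k+1)] and [A_(k+1)]; moving every such piece one place along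
    is a homeomorphism of [X \ {z}] onto [X \ {p, z}]
    ([homeo_sets_hotel]).  Hence the cards of the space [X \ {p}] are the
    [X \ {z}] with [z <> p].  A second copy of [A_0], disjoint from it,
    contains a point [p'] with [X \ {p'}] homeomorphic to [X \ {p}], so that
    [X \ {p}] has the same deck as [X]; but it is not compact
    ([universal_not_reconstructible]).

    Conversely, let [Z] have the deck of [X] without being homeomorphic to
    [X].  Then [Z] is Hausdorff and locally compact, and it is not compact,
    because a compact Hausdorff space is, among such spaces, determined by
    any one of its cards.  So
    [X \ {x}], being homeomorphic to some [Z \ {z}], has two ways out to
    [x]: towards [z], and towards infinity in [Z].  A point of [Z] with [n]
    local branches thus becomes a point of [X] with [n + 1] branches
    ([splits_card]); branches can be carried back from [X] to [Z]
    ([splits_back]), and after three rounds every point of [X] has at least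
    three branches.

    A compact metrizable space all of whose points have three branches has a
    clopen set inside every nonempty open set ([exists_clopen_sub]).  Indeed
    only countably many finite descriptions of branches exist, so two distinct
    points share one; comparing a branch of the one with the corresponding
    branch of the other yields an open set with at most one boundary point, a
    leaf ([exists_leaf]).  Leaves can be nested and shrunk to a point [p], and
    if no leaf contained a clopen set then [p] would have only one branch.

    So there are disjoint compact open sets in [Z] that leave every compact
    set.  Under each homeomorphism of [Z \ {z}] with [X \ {x}] they become
    a sequence of clopen sets converging to [x], of types that do not depend
    on [x], except that the one set which may contain [z] is lost.  To repair
    this the sets are chosen as unions of two disjoint homeomorphic halves,
    one of which always avoids [z] ([not_reconstructible_universal]). *)

Import Order.TTheory GRing.Theory Num.Theory.

Set Implicit Arguments.
Unset Strict Implicit.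
Unset Printing Implicit Defensive.

Local Open Scope classical_set_scope.

(** * Homeomorphisms between subsets *)

Lemma homeomorphic_refl (T : topologicalType) : homeomorphic T T.
Proof. by exists id, id; split=> // x; exact: cvg_id. Qed.

Lemma homeomorphic_sym (T U : topologicalType) :
  homeomorphic T U -> homeomorphic U T.
Proof. by move=> [f [g [fK gK cf cg]]]; exists g, f; split. Qed.

Lemma homeomorphic_trans (T U V : topologicalType) :
  homeomorphic T U -> homeomorphic U V -> homeomorphic T V.
Proof.
move=> [f [f' [fK f'K cf cf']]] [g [g' [gK g'K cg cg']]].
exists (g \o f), (f' \o g'); split.
- exact: can_comp.
- exact: can_comp.
- by move=> x; apply: continuous_comp; [exact: cf|exact: cg].
- by move=> x; apply: continuous_comp; [exact: cg'|exact: cf'].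
Qed.

Lemma homeo_class_eq (T U : topologicalType) :
  homeomorphic T U -> homeo_class T = homeo_class U.
Proof.
move=> TU; apply/funext => V; apply/propext; split; apply: homeomorphic_trans.
  exact: homeomorphic_sym.
exact: TU.
Qed.

(** Homeomorphisms between subsets, given by maps of the ambient spaces.
    Continuity is required at the points of the subset as points of the
    ambient space; for open subsets, the only ones for which this is used,
    that is continuity for the subspace topology. *)
Definition homeo_on (T U : topologicalType) (A : set T) (B : set U)
    (f : T -> U) (g : U -> T) : Prop :=
  [/\ forall t, A t -> B (f t) /\ g (f t) = t,
      forall s, B s -> A (g s) /\ f (g s) = s,
      forall t, A t -> {for t, continuous f} &
      forall s, B s -> {for s, continuous g}].

Definition homeo_sets (T U : topologicalType) (A : set T) (B : set U) : Prop :=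
  exists f g, homeo_on A B f g.

Lemma open_set_val (T : topologicalType) (A : set T) (W : set A) :
  open A -> open W -> open (set_val @` W).
Proof.
move=> oA [V oV <-].
have -> : set_val @` (set_val @^-1` V : set A) = A `&` V.
  apply/seteqP; split=> [_ [t Vt <-]|t [At Vt]].
    by split; [exact: set_valP | exact: Vt].
  by exists (SigSub (mem_set At)).
exact: openI.
Qed.

Lemma homeo_on_homeomorphic (T U : topologicalType) (A : set T) (B : set U)
    (f : T -> U) (g : U -> T) :
  homeo_on A B f g -> homeomorphic A B.
Proof.
have half (T' U' : topologicalType) (A' : set T') (B' : set U') (h : T' -> U')
    (hA : forall t, A' t -> B' (h t)) :
    (forall t, A' t -> {for t, continuous h}) ->
    continuous (fun a : A' => SigSub (mem_set (hA _ (set_valP a))) : B').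
  move=> ch; apply/continuousP => _ [V oV <-].
  exists (interior (h @^-1` V)); first exact: open_interior.
  apply/seteqP; split=> t /=; first by move/interior_subset.
  move=> Vt; apply: (ch _ (set_valP t)); exact: open_nbhs_nbhs.
move=> [fA gB cf cg].
have fB t : A t -> B (f t) by move/fA => [].
have gA s : B s -> A (g s) by move/gB => [].
exists (fun a => SigSub (mem_set (fB _ (set_valP a)))).
exists (fun b => SigSub (mem_set (gA _ (set_valP b)))); split.
- by move=> a; apply: val_inj => /=; exact: (fA _ (set_valP a)).2.
- by move=> b; apply: val_inj => /=; exact: (gB _ (set_valP b)).2.
- exact: half.
- exact: half.
Qed.

(** The values [u0] and [t0] off the two sets can be prescribed; a
    homeomorphism of punctured spaces will be extended by exchanging the two
    missing points. *)
Lemma homeomorphic_homeo_on (T U : topologicalType) (A : set T) (B : set U)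
    (t0 : T) (u0 : U) :
  open A -> open B -> homeomorphic A B ->
  exists f g, [/\ homeo_on A B f g, forall t, ~ A t -> f t = u0 &
                  forall s, ~ B s -> g s = t0].
Proof.
move=> oA oB [f [g [fK gK cf cg]]].
pose ext (T' U' : topologicalType) (A' : set T') (B' : set U') (u : U')
    (h : A' -> B') (t : T') : U' :=
  if pselect (A' t) is left At then set_val (h (SigSub (mem_set At))) else u.
have extE (T' U' : topologicalType) (A' : set T') (B' : set U') u h (a : A') :
    ext _ _ A' B' u h (set_val a) = set_val (h a).
  rewrite /ext; case: pselect => [Aa|/(_ (set_valP a)) //].
  by congr (set_val (h _)); apply: val_inj.
have extN (T' U' : topologicalType) (A' : set T') (B' : set U') u h t :
    ~ A' t -> ext _ _ A' B' u h t = u.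
  by rewrite /ext; case: pselect.
have extC (T' U' : topologicalType) (A' : set T') (B' : set U') u h t :
    open A' -> continuous h -> A' t ->
    {for t, continuous (ext _ _ A' B' u h)}.
  move=> oA' /continuousP ch At V; rewrite nbhsE => -[W [oW Wt] WV].
  set a := SigSub (mem_set At) : A'.
  rewrite -[t]/(set_val a) extE in Wt.
  rewrite nbhsE; exists (set_val @` (h @^-1` (set_val @^-1` W))).
    split; last by exists a.
    by apply: open_set_val => //; apply: ch; exists W.
  by move=> _ [b Wb <-] /=; rewrite extE; exact: WV.
exists (ext _ _ A B u0 f), (ext _ _ B A t0 g); split; last 2 first.
- by move=> t; exact: extN.
- by move=> t; exact: extN.
split.
- move=> t At; rewrite -[t]/(set_val (SigSub (mem_set At) : A)) !extE fK.
  by split => //; exact: set_valP.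
- move=> t At; rewrite -[t]/(set_val (SigSub (mem_set At) : B)) !extE gK.
  by split => //; exact: set_valP.
- by move=> t At; exact: extC.
- by move=> t At; exact: extC.
Qed.

Lemma homeo_setsP (T U : topologicalType) (A : set T) (B : set U)
    (t0 : T) (u0 : U) : open A -> open B ->
  homeo_sets A B <-> homeomorphic A B.
Proof.
move=> oA oB; split=> [[f [g fg]]|AB].
  exact: homeo_on_homeomorphic fg.
by have [f [g [fg _ _]]] := homeomorphic_homeo_on t0 u0 oA oB AB;
  exists f, g.
Qed.

Lemma homeo_sets_refl (T : topologicalType) (A : set T) : homeo_sets A A.
Proof. by exists id, id; split=> // t _; exact: cvg_id. Qed.

Lemma homeo_on_sym (T U : topologicalType) (A : set T) (B : set U) f g :
  homeo_on A B f g -> homeo_on B A g f.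
Proof. by case. Qed.

Lemma homeo_sets_sym (T U : topologicalType) (A : set T) (B : set U) :
  homeo_sets A B -> homeo_sets B A.
Proof. by move=> [f [g /homeo_on_sym gf]]; exists g, f. Qed.

Lemma homeo_sets_trans (T U V : topologicalType) (A : set T) (B : set U)
    (C : set V) :
  homeo_sets A B -> homeo_sets B C -> homeo_sets A C.
Proof.
move=> [f [f' [fA f'B cf cf']]] [g [g' [gB g'C cg cg']]].
exists (g \o f), (f' \o g'); split=> /=.
- by move=> t /fA[Bt ft]; have [Ct gt] := gB _ Bt; rewrite gt.
- by move=> t /g'C[Bt ft]; have [Ct gt] := f'B _ Bt; rewrite gt.
- move=> t At; apply: continuous_comp; first exact: cf.
  by apply: cg; apply: (fA _ At).1.
- move=> t At; apply: continuous_comp; first exact: cg'.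
  by apply: cf'; apply: (g'C _ At).1.
Qed.

Lemma homeo_on_restrict (T U : topologicalType) (A D : set T) (B : set U) f g :
  homeo_on A B f g -> D `<=` A ->
  homeo_on D (B `&` g @^-1` D) f g.
Proof.
move=> [fA gB cf cg] DA; split.
- by move=> t Dt; have [Bf gf] := fA _ (DA _ Dt); rewrite /= gf.
- by move=> s [Bs /= Ds]; split=> //; have [] := gB _ Bs.
- by move=> t /DA; exact: cf.
- by move=> s [Bs _]; exact: cg.
Qed.

Lemma open_preimage_on (T U : topologicalType) (B : set U) (D : set T)
    (g : U -> T) :
  open B -> open D -> (forall s, B s -> {for s, continuous g}) ->
  open (B `&` g @^-1` D).
Proof.
move=> oB oD cg; rewrite openE => s [Bs Ds].
apply: filterI; first exact: open_nbhs_nbhs.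
by apply: (cg _ Bs); exact: open_nbhs_nbhs.
Qed.

(** A map that is a homeomorphism on each piece of a partition into open sets
    is a homeomorphism.  This is how all homeomorphisms below that move
    infinitely many pieces are built. *)
Lemma homeo_sets_glue (T U : topologicalType) (t0 : T) (u0 : U) (I : Type)
    (P : I -> set T) (Q : I -> set U) :
  (forall i, open (P i)) -> (forall i, open (Q i)) ->
  (forall i j t, P i t -> P j t -> i = j) ->
  (forall i j t, Q i t -> Q j t -> i = j) ->
  (forall i, homeo_sets (P i) (Q i)) ->
  homeo_sets (\bigcup_i P i) (\bigcup_i Q i).
Proof.
move=> oP oQ dP dQ PQ.
have {PQ}[F FP] := choice PQ; have {FP}[G FG] := choice FP.
pose glue (T' U' : topologicalType) (u : U') (R : I -> set T')
    (h : I -> T' -> U') t :=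
  if pselect (exists i, R i t) is left e then h (projT1 (cid e)) t else u.
have glueE (T' U' : topologicalType) (u : U') (R : I -> set T') h i t :
    (forall i j t, R i t -> R j t -> i = j) ->
    R i t -> glue _ _ u R h t = h i t.
  move=> dR Rt; rewrite /glue; case: pselect => [e|]; last by case; exists i.
  by case: cid => j Rj /=; rewrite (dR _ _ _ Rj Rt).
have glueC (T' U' : topologicalType) (u : U') (R : I -> set T') h i t :
    (forall i j t, R i t -> R j t -> i = j) -> open (R i) ->
    R i t -> {for t, continuous (h i)} ->
    {for t, continuous (glue _ _ u R h)}.
  move=> dR oR Rt ch; rewrite /prop_for /continuous_at (glueE _ _ _ _ _ i) //.
  have near_eq : {near nbhs t, h i =1 glue _ _ u R h}.
    have : nbhs t (R i) by exact: open_nbhs_nbhs.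
    by apply: filterS => s Rs; rewrite (glueE _ _ _ _ _ i).
  by apply: cvg_trans ch; exact: near_eq_cvg.
exists (glue _ _ u0 P F), (glue _ _ t0 Q G); split.
- move=> t [i _ Pt]; rewrite (glueE _ _ _ _ _ i) //.
  have [fP _ _ _] := FG i; have [Qf gf] := fP _ Pt.
  by rewrite (glueE _ _ _ _ _ i) //; split=> //; exists i.
- move=> t [i _ Pt]; rewrite (glueE _ _ _ _ _ i) //.
  have [_ fP _ _] := FG i; have [Qf gf] := fP _ Pt.
  by rewrite (glueE _ _ _ _ _ i) //; split=> //; exists i.
- move=> t [i _ Pt]; have [_ _ c _] := FG i.
  exact: glueC dP (oP i) Pt (c _ Pt).
- move=> t [i _ Pt]; have [_ _ _ c] := FG i.
  exact: glueC dQ (oQ i) Pt (c _ Pt).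
Qed.

(** * Compact spaces with a development *)

Lemma compact_nested (T : topologicalType) (A : nat -> set T) :
  compact [set: T] -> (forall n, closed (A n)) -> (forall n, A n !=set0) ->
  (forall n, A n.+1 `<=` A n) -> exists p, forall n, A n p.
Proof.
move=> cT cA A0 AS.
have AD m n : A (m + n)%N `<=` A m.
  elim: n => [|n IH]; first by rewrite addn0.
  by rewrite addnS => t /AS /IH.
have FA : ProperFilter (filter_from [set: nat] A).
  apply: filter_from_proper => [|n _]; last exact: A0.
  apply: filter_from_filter => [|m n _ _]; first by exists 0%N.
  exists (m + n)%N => // t At; split; first exact: AD At.
  by rewrite addnC in At; exact: AD At.
have [p [_ clp]] := cT _ FA filterT.
exists p => n; apply: cA => B Bp; apply: clp => //; by exists n.
Qed.

(** A metric enters only through the families of sets whose points have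
    distances below [1 / (n + 1)].  Stating this axiomatically (such a family
    is a development in the sense of Moore) lets the metric be transported
    along a homeomorphism. *)
Definition development (T : topologicalType) (small : nat -> set T -> Prop) :
    Prop :=
  [/\ forall n x, exists U, [/\ open U, U x & small n U],
      forall n (A B : set T), small n A -> B `<=` A -> small n B,
      forall m n (A : set T), (m <= n)%N -> small n A -> small m A &
      forall x U, nbhs x U ->
        exists n, forall A : set T, small n A -> A x -> A `<=` U].

Lemma metrizable_development (R : realType) (X : topologicalType) :
  metrizable R X ->
  hausdorff_space X /\ exists small, @development X small.
Proof.
move=> [M [f [g [fK gK cf cg]]]]; split.
  move=> p q pq; apply: (can_inj fK); apply: (@metric_hausdorff R M).
  move=> A B fpA fqB.
  have [t [At Bt]] := pq _ _ (cf p _ fpA) (cf q _ fqB).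
  by exists (f t).
exists (fun n A => forall s t, A s -> A t ->
  ball (f s) (n.+1%:R^-1 : R)%R (f t)).
split.
- move=> n x; set e := (n.+1%:R^-1 / 2 : R)%R.
  have e0 : (0 < e)%R by rewrite /e divr_gt0 // invr_gt0.
  exists (f @^-1` (interior (ball (f x) e))); split.
  + by apply: open_comp; [move=> t _; exact: cf | exact: open_interior].
  + exact: nbhsx_ballx.
  + move=> s t /= /interior_subset sx /interior_subset tx.
    rewrite [X in ball _ X](splitr (n.+1%:R^-1)%R).
    by apply: ball_triangle tx; exact: ball_sym.
- by move=> n A B sA BA s t /BA As /BA At; exact: sA.
- move=> m n A mn sA s t As At; apply: le_ball (sA _ _ As At).
  by rewrite lef_pV2 ?posrE // ler_nat.
- move=> x U xU.
  have : nbhs (f x) (g @^-1` U) by apply: cg; rewrite fK.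
  move=> /nbhs_ballP [_/posnumP[e] eU].
  have [n ne] := @ltr_add_invr R 0%R e%:num (gt0 e); rewrite add0r in ne.
  exists n => A sA Ax t At; rewrite -[t]fK; apply: eU.
  exact: le_ball (ltW ne) _ (sA _ _ Ax At).
Qed.

Lemma hausdorff_sep (T : topologicalType) (x y : T) :
  hausdorff_space T -> x <> y ->
  exists U V : set T, [/\ open U, open V, U x, V y & forall t, U t -> ~ V t].
Proof.
rewrite open_hausdorff => hT /eqP /hT[[U V] /= [/set_mem Ux /set_mem Vy]].
move=> [oU oV /eqP UV0]; exists U, V; split=> // t Ut Vt.
by have : (U `&` V) t by []; rewrite UV0.
Qed.

Lemma hausdorff_closed1 (T : topologicalType) (x : T) :
  hausdorff_space T -> closed [set x].
Proof. by move/hausdorff_accessible/accessible_closed_set1; exact. Qed.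

Lemma open_setC1 (T : topologicalType) (x : T) :
  hausdorff_space T -> open (~` [set x]).
Proof. by move=> hT; apply: closed_openC; exact: hausdorff_closed1. Qed.

Lemma nested_le (T : Type) (A : nat -> set T) :
  (forall k, A k.+1 `<=` A k) -> forall m n, (m <= n)%N -> A n `<=` A m.
Proof.
move=> AS m n /subnK <-; elim: (n - m)%N => // k IH.
by rewrite addSn => t /AS /IH.
Qed.

(** Away from its limit, a converging sequence of sets is locally finite. *)
Lemma closed_converging (T : topologicalType) (z : T) (C : nat -> set T) :
  hausdorff_space T -> (forall k, closed (C k)) -> sets_converge C z ->
  closed ([set z] `|` \bigcup_k C k).
Proof.
move=> hT cC Cz.
have cN N : closed [set t | exists2 k, (k < N)%N & C k t].
  elim: N => [|N IH].
    have -> : [set t | exists2 k, (k < 0)%N & C k t] = set0.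
      by apply/seteqP; split=> // t [].
    exact: closed0.
  have -> : [set t | exists2 k, (k < N.+1)%N & C k t] =
      [set t | exists2 k, (k < N)%N & C k t] `|` C N.
    apply/seteqP; split=> [t [k]|t [[k kN Ct]|Ct]].
    - rewrite ltnS leq_eqVlt => /orP[/eqP ->|kN Ct]; first by right.
      by left; exists k.
    - by exists k => //; exact: ltnW.
    - by exists N.
  exact: closedU.
rewrite -openC openE => t /not_orP[tz tC].
have [U [V [oU oV Ut Vz UV]]] := hausdorff_sep hT tz.
have [N _ NV] := Cz V (open_nbhs_nbhs (conj oV Vz)).
apply: (@filterS _ _ _ (U `&` ~` [set t | exists2 k, (k < N)%N & C k t])).
  move=> s [Us nCs] [sz|[k _ Cs]]; first by apply: (UV s) => //; rewrite sz.
  have [kN|Nk] := ltnP k N; first by apply: nCs; exists k.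
  by apply: (UV s Us); exact: NV Cs.
apply: open_nbhs_nbhs; split; first by apply: openI => //; exact: closed_openC.
by split=> // -[k _ Ck]; apply: tC; exists k.
Qed.

(** * From a universal sequence to a second space with the same deck *)

(** Hilbert's hotel.  Through [A k ~ C k], each guest room [C k] consists of a
    copy of [A k `\` A k.+1] and a copy of [A k.+1]; the former is sent to
    [A k `\` A k.+1] itself, the latter to [C k.+1].  As [C 0 = A 0], what is
    reached inside [A 0] is the union of the layers [A k `\` A k.+1], which
    misses exactly [p], while all the [C k.+1] are filled. *)
Lemma homeo_sets_hotel (T : topologicalType) (p z : T) (A C : nat -> set T) :
  hausdorff_space T ->
  (forall k, clopen (A k)) -> (forall k, A k.+1 `<=` A k) ->
  (forall k, A k p) -> (forall t, (forall k, A k t) -> t = p) ->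
  (forall k, clopen (C k)) -> (forall i j t, C i t -> C j t -> i = j) ->
  (forall k, ~ C k z) -> sets_converge C z -> C 0%N = A 0%N ->
  (forall k, homeo_sets (A k) (C k)) ->
  homeo_sets (~` [set z]) (~` [set p; z]).
Proof.
move=> hT cA AS Ap Ap1 cC dC Cz Ccvg C0 AC.
have {AC}[f fP] := choice AC; have {fP}[g fg] := choice fP.
have A0 k : A k `<=` A 0%N by exact: nested_le.
have drop i j t : A i t -> ~ A i.+1 t -> A j t -> (j <= i)%N.
  move=> Ai nAi Aj; rewrite leqNgt; apply/negP => ij.
  exact/nAi/(nested_le AS ij).
have level t : A 0%N t -> t <> p -> exists k, A k t /\ ~ A k.+1 t.
  move=> At tp; have [n nAn] : exists n, ~ A n t.
    by apply/existsNP => /Ap1.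
  elim: n nAn => // n IH nAn.
  by have [An|/IH //] := pselect (A n t); exists n.
pose rest := ~` ([set z] `|` \bigcup_k C k).
pose P (i : option (nat * bool)) : set T := match i with
  | None => rest
  | Some (k, false) => C k `&` g k @^-1` (A k `\` A k.+1)
  | Some (k, true) => C k `&` g k @^-1` (A k.+1) end.
pose Q (i : option (nat * bool)) : set T := match i with
  | None => rest
  | Some (k, false) => A k `\` A k.+1
  | Some (k, true) => C k.+1 end.
have oR : open rest.
  apply: closed_openC; apply: closed_converging => // k; exact: (cC k).2.
have oD k : open (A k `\` A k.+1).
  by apply: openI; [exact: (cA k).1 | apply: closed_openC; exact: (cA k.+1).2].
have restC t k : rest t -> C k t -> False.
  by move=> nt Ct; apply: nt; right; exists k.
have -> : ~` [set z] = \bigcup_i P i.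
  apply/seteqP; split=> [t tz|t [[[k []]|] _ /=]].
  - have [[k _ Ct]|nCt] := pselect ((\bigcup_k C k) t); last first.
      by exists None => //= -[].
    have [_ gC _ _] := fg k; have [Ag _] := gC _ Ct.
    by have [Ag1|nAg1] := pselect (A k.+1 (g k t));
      [exists (Some (k, true))|exists (Some (k, false))].
  - by move=> [Ct _] tz; apply: (Cz k); rewrite -tz.
  - by move=> [Ct _] tz; apply: (Cz k); rewrite -tz.
  - by move=> nt tz; apply: nt; left.
have -> : ~` [set p; z] = \bigcup_i Q i.
  apply/seteqP; split=> [t /not_orP[tp tz]|t [[[k []]|] _ /=]].
  - have [[k _ Ct]|nCt] := pselect ((\bigcup_k C k) t); last first.
      by exists None => //= -[].
    case: k Ct => [|k] Ct; last by exists (Some (k, true)).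
    rewrite C0 in Ct; have [k Ak] := level _ Ct tp.
    by exists (Some (k, false)).
  - move=> Ct [tp|tz]; last by apply: (Cz k.+1); rewrite -tz.
    have : C 0%N t by rewrite C0 tp.
    by move=> /dC /(_ Ct).
  - move=> [Ak nAk] [tp|tz]; first by apply: nAk; rewrite tp.
    by apply: (Cz 0%N); rewrite C0 -tz; exact: A0 Ak.
  - move=> nt [tp|tz]; last by apply: nt; left.
    by apply: nt; right; exists 0%N; rewrite // C0 tp.
apply: homeo_sets_glue => //.
- move=> [[k []]|] //=; apply: open_preimage_on.
  + exact: (cC k).1.
  + exact: (cA k.+1).1.
  + by have [_ _ _ cg] := fg k.
  + exact: (cC k).1.
  + exact: oD.
  + by have [_ _ _ cg] := fg k.
- by move=> [[k []]|] //=; exact: (cC k.+1).1.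
- move=> [[i []]|] [[j []]|] t //=.
  + by move=> [Ci _] [Cj _]; rewrite (dC _ _ _ Ci Cj).
  + by move=> [Ci Ai] [Cj [Aj nAj]]; have ij := dC _ _ _ Ci Cj; subst j.
  + by move=> [Ci _] /restC /(_ Ci).
  + by move=> [Ci [Ai nAi]] [Cj Aj]; have ij := dC _ _ _ Ci Cj; subst j.
  + by move=> [Ci _] [Cj _]; rewrite (dC _ _ _ Ci Cj).
  + by move=> [Ci _] /restC /(_ Ci).
  + by move=> /restC r [/r].
  + by move=> /restC r [/r].
- move=> [[i []]|] [[j []]|] t //=.
  + by move=> Ci Cj; have [->] := dC _ _ _ Ci Cj.
  + by move=> Ci [/A0]; rewrite -C0 => /dC /(_ Ci).
  + by move=> Ci /restC /(_ Ci).
  + by move=> [/A0]; rewrite -C0 => C0t _ Ci; have := dC _ _ _ C0t Ci.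
  + move=> [Ai nAi] [Aj nAj]; congr (Some (_, _)); apply/eqP.
    by rewrite eqn_leq (drop _ _ _ Ai nAi Aj) (drop _ _ _ Aj nAj Ai).
  + by move=> [/A0]; rewrite -C0 => C0t _ /restC /(_ C0t).
  + by move=> /restC r /r.
  + by move=> /restC r [/A0]; rewrite -C0 => /r.
- have hk k D : D `<=` A k -> homeo_sets (C k `&` g k @^-1` D) D.
    move=> DA; apply: homeo_sets_sym; exists (f k), (g k).
    exact: homeo_on_restrict.
  move=> [[k []]|] /=.
  + apply: homeo_sets_trans (hk _ _ (AS k)) _.
    by exists (f k.+1), (g k.+1).
  + by apply: hk => t [].
  + exact: homeo_sets_refl.
Qed.

(** Exchanging two disjoint homeomorphic clopen sets is a self-homeomorphism,
    here restricted to the complement of a point. *)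
Lemma homeo_sets_swap (T : topologicalType) (A A' : set T) f g (p : T) :
  hausdorff_space T -> clopen A -> clopen A' -> (forall t, A t -> ~ A' t) ->
  homeo_on A A' f g -> A p -> homeo_sets (~` [set p]) (~` [set f p]).
Proof.
move=> hT [oA cA] [oA' cA'] dAA' fg Ap.
have [fA gA' _ cg] := fg; have [A'fp gfp] := fA _ Ap.
have oR : open (~` (A `|` A')) by apply: closed_openC; exact: closedU.
have oAp : open (A `\ p) by apply: openI => //; exact: open_setC1.
have oAfp : open (A' `\ f p) by apply: openI => //; exact: open_setC1.
pose P (i : option bool) := match i with
  | None => ~` (A `|` A') | Some true => A `\ p | Some false => A' end.
pose Q (i : option bool) := match i with
  | None => ~` (A `|` A') | Some true => A' `\ f p | Some false => A end.
have -> : ~` [set p] = \bigcup_i P i.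
  apply/seteqP; split=> [t tp|t [[[]|] _] /=].
  - have [At|nAt] := pselect (A t); first by exists (Some true).
    have [A't|nA't] := pselect (A' t); first by exists (Some false).
    by exists None => //= -[].
  - by move=> [].
  - by move=> A't tp; apply: (dAA' p) => //; rewrite -tp.
  - by move=> nt tp; apply: nt; left; rewrite tp.
have -> : ~` [set f p] = \bigcup_i Q i.
  apply/seteqP; split=> [t tp|t [[[]|] _] /=].
  - have [At|nAt] := pselect (A t); first by exists (Some false).
    have [A't|nA't] := pselect (A' t); first by exists (Some true).
    by exists None => //= -[].
  - by move=> [].
  - by move=> At tp; apply: (dAA' t) => //; rewrite tp.
  - by move=> nt tp; apply: nt; right; rewrite tp.
apply: homeo_sets_glue => //.
- by move=> [[]|].
- by move=> [[]|].
- move=> [[]|] [[]|] t //=.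
  + by move=> [/dAA' At _] /At.
  + by move=> [At _] []; left.
  + by move=> A't [/dAA' /(_ A't)].
  + by move=> A't []; right.
  + by move=> nt [At _]; case: nt; left.
  + by move=> nt A't; case: nt; right.
- move=> [[]|] [[]|] t //=.
  + by move=> [A't _] /dAA'.
  + by move=> [A't _] []; right.
  + by move=> At [A't _]; have := dAA' _ At.
  + by move=> At []; left.
  + by move=> nt [A't _]; case: nt; right.
  + by move=> nt At; case: nt; left.
- move=> [[]|] /=; last exact: homeo_sets_refl.
    have <- : A' `&` g @^-1` (A `\ p) = A' `\ f p.
      apply/seteqP; split=> t [A't].
        by move=> /= [_ gtp]; split=> // tfp; apply: gtp; rewrite tfp.
      move=> /= tfp; have [Agt fgt] := gA' _ A't.
      by split=> //; split=> // gtp; apply: tfp; rewrite -gtp.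
    by exists f, g; apply: homeo_on_restrict fg _ => t [].
  by exists g, f; exact: homeo_on_sym.
Qed.

Lemma homeo_on_set_val (T : topologicalType) (A : set T) (w : A) :
  open A -> exists g : T -> A, homeo_on [set: A] A set_val g.
Proof.
move=> oA.
exists (fun t => if pselect (A t) is left At then SigSub (mem_set At) else w).
split.
- move=> a _; split; first exact: set_valP.
  case: pselect => [Aa|/(_ (set_valP a)) //]; exact: val_inj.
- by move=> t At; case: pselect.
- by move=> t _; exact: initial_continuous.
- move=> t At W; case: pselect => // At' [/= W' [[V oV <-] Vt VW]].
  have : nbhs t (A `&` V) by apply: open_nbhs_nbhs; split => //; exact: openI.
  apply: filterS => s [As Vs] /=; case: pselect => // As'; exact: VW.
Qed.

(** The space with the deck of [X] is [X] without the limit point [p] of a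
    nested sequence [A k = B (u k).1 (u k).2] with [(u k).2] increasing. *)
Lemma universal_not_reconstructible (X : topologicalType)
    (small : nat -> set X -> Prop) :
  compact [set: X] -> hausdorff_space X -> development small ->
  [set: X] !=set0 -> has_universal_sequence X -> ~ reconstructible X.
Proof.
move=> cX hX [dex dsub dle dnbhs] [x0 _] [B [BP BB]].
have tB x i j t : B x i t -> B x j t -> i = j.
  by move=> Bi Bj; have [tr _ _ _] := BP x; apply: tr => //; exists t.
have B0 x n : B x n !=set0 by have [_ + _ _] := BP x; exact.
have cB x n : clopen (B x n) by have [_ _ + _] := BP x; exact.
have Bcvg x : sets_converge (B x) x by have [_ _ _] := BP x.
have hB x y n : homeo_sets (B x n) (B y n).
  by apply/(homeo_setsP x0 x0 (cB _ _).1 (cB _ _).1); exact: BB.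
have [a [b ab]] : exists a b : X, a <> b.
  have [a Ba] := B0 x0 0%N; have [b Bb] := B0 x0 1%N; exists a, b => ab.
  by rewrite ab in Ba; have := tB _ _ _ _ Ba Bb.
have [n0 dab] : exists n0, forall t, B a n0 t -> ~ B b n0 t.
  have [U [V [oU oV Ua Vb UV]]] := hausdorff_sep hX ab.
  have [N _ NU] := Bcvg a U (open_nbhs_nbhs (conj oU Ua)).
  have [M _ MV] := Bcvg b V (open_nbhs_nbhs (conj oV Vb)).
  exists (maxn N M) => t Bat Bbt; apply: (UV t).
    by apply: NU Bat; exact: leq_maxl.
  by apply: MV Bbt; exact: leq_maxr.
(* A state [(y, n)] stands for the set [B y n]. *)
pose step (s s' : X * nat) := [/\ (s.2 < s'.2)%N,
  B s'.1 s'.2 `<=` B s.1 s.2 & small s.2 (B s'.1 s'.2)].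
have stepP s : {s' | step s s'}.
  apply: cid; have [y By] := B0 s.1 s.2.
  have [U [oU Uy sU]] := dex s.2 y.
  have [N _ NB] := Bcvg y _ (open_nbhs_nbhs
    (conj (openI oU (cB s.1 s.2).1) (conj Uy By))).
  exists (y, maxn N s.2.+1); split=> /=; first exact: leq_maxr.
    by move=> t /(NB _ (leq_maxl _ _)) [].
  by apply: dsub sU _ => t /(NB _ (leq_maxl _ _)) [].
have [u [u0 uS]] := dependent_choice stepP (a, n0).
pose A k := B (u k).1 (u k).2.
have AS k : A k.+1 `<=` A k by have [] := uS k.
have mono i j : (i < j)%N -> ((u i).2 < (u j).2)%N.
  elim: j => // j IH; rewrite ltnS leq_eqVlt => /orP[/eqP ->|/IH ij].
    by have [] := uS j.
  by apply: ltn_trans ij _; have [] := uS j.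
have ule k : (k <= (u k).2)%N.
  by elim: k => // k IH; apply: leq_ltn_trans IH _; exact: mono.
have [p Ap] : exists p, forall n, A n p.
  by apply: compact_nested => // n; [exact: (cB _ _).2 | exact: B0].
have Ap1 t : (forall k, A k t) -> t = p.
  move=> At; apply: contrapT => /nesym pt.
  have [U [V [oU oV Up Vt UV]]] := hausdorff_sep hX pt.
  have [n nU] := dnbhs p U (open_nbhs_nbhs (conj oU Up)).
  apply: (UV t) Vt; apply: (nU (A n.+1)) => //.
  by apply: dle (ule n) _; have [] := uS n.
have hotel z : z <> p -> homeo_sets (~` [set z]) (~` [set p; z]).
  move=> zp; have [K0 nAz] : exists n, ~ A n z.
    by apply/existsNP => /Ap1.
  have [M1 M1P] : exists M, forall n, (M <= n)%N -> ~ B z n z.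
    have [[m Bm]|nB] := pselect (exists m, B z m z).
      by exists m.+1 => n mn Bn; move: mn; rewrite (tB _ _ _ _ Bm Bn) ltnn.
    by exists 0%N => n _ Bn; apply: nB; exists n.
  have [M2 _ M2P] : \forall n \near \oo, B z n `<=` ~` A K0.
    apply: Bcvg; apply: open_nbhs_nbhs; split=> //.
    by apply: closed_openC; exact: (cB _ _).2.
  (* Beyond [K] the sets [B z n] avoid both [z] and [A K]. *)
  pose K := maxn K0 (maxn M1 M2).
  have KM1 k : (M1 <= (u (K + k)%N).2)%N.
    apply: leq_trans (ule _); apply: leq_trans (leq_addr _ _).
    by rewrite /K !leq_max leqnn orbT.
  have KM2 k : (M2 <= (u (K + k)%N).2)%N.
    apply: leq_trans (ule _); apply: leq_trans (leq_addr _ _).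
    by rewrite /K !leq_max leqnn !orbT.
  have AK : A K `<=` A K0 by apply: nested_le => //; exact: leq_maxl.
  pose C k := if k is 0%N then A K else B z (u (K + k)%N).2.
  have dC k t : A K t -> ~ B z (u (K + k)%N).2 t.
    by move=> /AK AKt /(M2P _ (KM2 _)).
  apply: (@homeo_sets_hotel _ p z (fun k => A (K + k)%N) C) => //.
  - by move=> k; exact: cB.
  - by move=> k; rewrite addnS; exact: AS.
  - move=> t At; apply: Ap1 => k; have := At k; apply: nested_le => //.
    exact: leq_addl.
  - by move=> [|k]; exact: cB.
  - move=> [|i] [|j] t //=; first by move=> /dC /[apply].
      by move=> /[swap] /dC /[apply].
    move=> Bi Bj; have := tB _ _ _ _ Bi Bj => uij; apply/eqP.
    have [ij|ji|//] := ltngtP i.+1 j.+1.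
    + have := mono (K + i.+1)%N (K + j.+1)%N; rewrite ltn_add2l uij ltnn.
      by move=> /(_ ij).
    + have := mono (K + j.+1)%N (K + i.+1)%N; rewrite ltn_add2l uij ltnn.
      by move=> /(_ ji).
  - by move=> [/AK //|k] /=; exact: M1P.
  - move=> U /Bcvg [N _ NU]; exists N.+1 => // -[//|k] /= Nk.
    apply: NU => /=; apply: leq_trans (ule _); apply: leq_trans (leq_addl _ _).
    exact: ltnW.
  - by rewrite /= addn0.
  - move=> [|k] /=; first by rewrite addn0; exact: homeo_sets_refl.
    exact: hB.
(* Without [p'], the card of [X] at [p] itself might be missing from the deck
   of [X \ {p}]. *)
have [p' pp' hp'] : exists2 p', p' <> p & homeo_sets (~` [set p]) (~` [set p']).
  have A0p : B a n0 p by have := Ap 0%N; rewrite /A u0.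
  have [f [g fg]] := hB a b n0; have [fA _ _ _] := fg.
  exists (f p); last by apply: homeo_sets_swap fg _.
  by move=> fpp; apply: (dab p) => //; rewrite -fpp; exact: (fA _ A0p).1.
pose Z : set X := ~` [set p].
have oZ : open Z by exact: open_setC1.
have hZ (w : Z) :
    homeomorphic (~` [set w] : set Z) (~` [set set_val w] : set X).
  have [g hg] := homeo_on_set_val w oZ; have [_ gZ _ _] := hg.
  have wp : set_val w <> p := set_valP w.
  apply: homeomorphic_trans; last first.
    apply: homeomorphic_sym.
    have [f' [g' fg']] := hotel _ wp; exact: homeo_on_homeomorphic fg'.
  suff <- : Z `&` g @^-1` (~` [set w]) = ~` [set p; set_val w].
    exact: homeo_on_homeomorphic (homeo_on_restrict hg _).
  apply/seteqP; split=> [t [Zt gtw] [tp|tw]|t /not_orP[tp tw]].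
  - exact: Zt.
  - apply: gtw; apply: val_inj; rewrite -[RHS]/(set_val w) -tw.
    exact: (gZ _ Zt).2.
  - split=> //= gtw; apply: tw; rewrite -gtw.
    by symmetry; exact: (gZ _ tp).2.
have dZX : deck Z = deck X.
  apply/funext => C; apply/propext; split=> [[w ->]|[x ->]].
    by exists (set_val w); apply: homeo_class_eq.
  have [xp|xp] := pselect (x = p).
    have Zp' : Z p' := pp'.
    exists (SigSub (mem_set Zp') : Z); apply: homeo_class_eq.
    apply: homeomorphic_trans (homeomorphic_sym (hZ _)).
    by have [f [g fg]] := hp'; rewrite xp; exact: homeo_on_homeomorphic fg.
  have Zx : Z x := xp.
  exists (SigSub (mem_set Zx) : Z); apply: homeo_class_eq.
  by apply: homeomorphic_sym; exact: hZ.
move=> /(_ _ dZX) [f [g [fK gK cf cg]]].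
have cmpZ : compact Z.
  have -> : Z = (set_val \o g) @` [set: X].
    apply/seteqP; split=> [t Zt|_ [t _ <-]]; last exact: set_valP.
    by exists (f (SigSub (mem_set Zt))) => //=; rewrite fK.
  apply: continuous_compact => //; apply: continuous_subspaceT => t.
  by apply: continuous_comp; [exact: cg | exact: initial_continuous].
have op : open [set p] by rewrite -closedC; exact: compact_closed.
have [N _ NB] := Bcvg p _ (open_nbhs_nbhs (conj op (erefl p))).
have [t1 Bt1] := B0 p N; have [t2 Bt2] := B0 p N.+1.
have t1p := NB N (leqnn _) _ Bt1; have t2p := NB N.+1 (leqnSn _) _ Bt2.
rewrite t1p in Bt1; rewrite t2p in Bt2.
have /eqP := tB _ _ _ _ Bt1 Bt2.
by rewrite -[X in X == _]addn0 -addn1 eqn_add2l.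
Qed.

(** * Three branches at every point produce clopen sets *)

(** The [N i] are branches at [x]: they cut a punctured neighbourhood of [x]
    into [n] open pieces, each of which accumulates at [x]. *)
Definition splits (n : nat) (T : topologicalType) (x : T) (N : 'I_n -> set T) :
    Prop :=
  [/\ forall i, open (N i), forall i j t, N i t -> N j t -> i = j,
      forall i, ~ N i x, forall i, closure (N i) x &
      open ([set x] `|` \bigcup_i N i)].

Lemma dependent_choice_inv (S : Type) (ok : S -> Prop)
    (step : nat -> S -> S -> Prop) (s0 : S) :
  ok s0 -> (forall n s, ok s -> exists s', ok s' /\ step n s s') ->
  exists u, u 0%N = s0 /\ forall n, ok (u n) /\ step n (u n) (u n.+1).
Proof.
move=> ok0 ex.
pose R (a b : nat * {s | ok s}) :=
  b.1 = a.1.+1 /\ step a.1 (projT1 a.2) (projT1 b.2).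
have RP a : {b | R a b}.
  apply: cid; have [s' [oks' st]] := ex a.1 _ (projT2 a.2).
  by exists (a.1.+1, exist _ s' oks').
have [v [v0 vS]] := dependent_choice RP (0%N, exist _ s0 ok0).
have v1 n : (v n).1 = n.
  by elim: n => [|n IH]; [rewrite v0 | have [-> _] := vS n; rewrite IH].
exists (fun n => projT1 (v n).2); split; first by rewrite v0.
move=> n; split; first exact: projT2 (v n).2.
by have [_] := vS n; rewrite v1.
Qed.

(** Extracted from [near_covering], with the filter of all finite lists that
    contain a given one, so that no base point of [T] is involved. *)
Lemma compact_finite_cover (T : topologicalType) (K : set T) (I : choiceType)
    (F : I -> set T) :
  compact K -> (forall i, open (F i)) -> (forall x, K x -> exists i, F i x) ->
  exists s : seq I, forall x, K x -> exists2 i, i \in s & F i x.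
Proof.
move=> /compact_near_coveringP cK oF KF.
pose above (s0 : seq I) : set (seq I) := [set s | {subset s0 <= s}].
have fF : Filter (filter_from [set: seq I] above).
  apply: filter_from_filter; first by exists [::].
  move=> s1 s2 _ _; exists (s1 ++ s2) => // s s12; split=> i si; apply: s12;
    by rewrite mem_cat si ?orbT.
have [|s _ sK] := cK _ _ (fun s x => exists2 i, i \in s & F i x) fF.
  move=> x /KF[i Fi].
  exists (F i, above [:: i]); first split=> /=.
  - exact: open_nbhs_nbhs.
  - by exists [:: i].
  - by move=> [t s] /= [Ft si]; exists i => //; apply: si; rewrite mem_head.
by exists s => x Kx; apply: (sK s) Kx.
Qed.

Definition countable_base (T : topologicalType) (b : nat -> set T) : Prop :=
  (forall n, open (b n)) /\
  forall x U, nbhs x U -> exists n, b n x /\ b n `<=` U.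

Lemma compact_countable_base (T : topologicalType)
    (small : nat -> set T -> Prop) :
  compact [set: T] -> development small -> exists b, @countable_base T b.
Proof.
move=> cT [dex dsub dle dnbhs].
have /choice[U UP] : forall nx : nat * T,
    exists U, [/\ open U, U nx.2 & small nx.1 U] by move=> nx; exact: dex.
have /choice[s sP] : forall n, exists s : seq T,
    forall x, [set: T] x -> exists2 y, y \in s & U (n, y) x.
  move=> n; apply: compact_finite_cover => // [y|x _].
    by have [] := UP (n, y).
  by exists x; have [] := UP (n, x).
pose b m := if unpickle m is Some (n, i)
  then nth set0 [seq U (n, y) | y <- s n] i else set0.
exists b; split=> [m|x V /dnbhs[n nV]].
  rewrite /b; case: unpickle => [[n i]|]; last exact: open0.
  have [si|si] := ltnP i (size (s n)); last by rewrite nth_default ?size_map //;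
    exact: open0.
  case: (s n) si => // y0 s' si; rewrite (nth_map y0) //.
  by have [] := UP (n, nth y0 (y0 :: s') i).
have [y ys Uyx] := sP n x I; exists (pickle (n, index y (s n))).
rewrite /b pickleK (nth_map y) ?index_mem // nth_index //; split=> //.
by apply: nV => //; have [] := UP (n, y).
Qed.

Lemma compact_basic_cover (T : topologicalType) (b : nat -> set T)
    (K O : set T) :
  countable_base b -> compact K -> open O -> K `<=` O ->
  exists s : seq nat, (forall m, m \in s -> b m `<=` O) /\
    forall t, K t -> exists2 m, m \in s & b m t.
Proof.
move=> [ob bb] cK oO KO.
pose F m := [set t | b m t /\ b m `<=` O].
have oF m : open (F m).
  have [bO|nbO] := pselect (b m `<=` O).
    by have -> : F m = b m by [apply/seteqP; split=> [t []|]].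
  have -> : F m = set0 by apply/seteqP; split=> // t [].
  exact: open0.
have [|s sP] := compact_finite_cover cK oF.
  move=> t /KO Ot; have [m [bt bO]] := bb _ _ (open_nbhs_nbhs (conj oO Ot)).
  by exists m.
exists [seq m <- s | `[< b m `<=` O >]]; split=> [m|t /sP[m ms [bt bO]]].
  by rewrite mem_filter => /andP[/asboolP].
by exists m => //; rewrite mem_filter ms andbT; exact/asboolP.
Qed.

Lemma compact_hausdorff_regular (T : topologicalType) (x : T) (W : set T) :
  compact [set: T] -> hausdorff_space T -> open W -> W x ->
  exists V, [/\ open V, V x & closure V `<=` W].
Proof.
move=> cT hT oW Wx.
have [A xA AW] := compact_regular hT cT filterT (open_nbhs_nbhs (conj oW Wx)).
exists (interior A); split=> //; first exact: open_interior.
by apply: subset_trans AW; apply: closureS; exact: interior_subset.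
Qed.

(** A Baire category argument: if [code] were injective on [G], nested open
    sets could avoid the points of code [0], [1], [2], and so on, one after the
    other. *)
Lemma exists_same_code (T : topologicalType) (code : T -> nat) (G : set T) :
  compact [set: T] -> hausdorff_space T -> (forall x : T, ~ open [set x]) ->
  open G -> G !=set0 ->
  exists x y, [/\ G x, G y, x <> y & code x = code y].
Proof.
move=> cT hT noiso oG G0; apply: contrapT => inj.
pose ok (H : set T) := [/\ open H, H !=set0 & H `<=` G].
pose step n (H H' : set T) :=
  closure H' `<=` H /\ forall t, H' t -> code t <> n.
have okG : ok G by split.
have stepP n H : ok H -> exists H', ok H' /\ step n H H'.
  move=> [oH [h Hh] HG].
  have [W [oW [w Ww] WH Wn]] : exists W, [/\ open W, W !=set0, W `<=` H &
      forall t, W t -> code t <> n].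
    have [[t [Ht tn]]|nt] := pselect (exists t, H t /\ code t = n); last first.
      by exists H; split=> //; [exists h | move=> t Ht tn; apply: nt; exists t].
    exists (H `\ t); split.
    - by apply: openI => //; exact: open_setC1.
    - apply: contrapT => nW; apply: (noiso t).
      suff <- : H = [set t] by [].
      apply/seteqP; split=> [s Hs|s ->//]; apply: contrapT => st.
      by apply: nW; exists s.
    - by move=> s [].
    - move=> s [Hs st] sn; apply: inj; exists s, t.
      by split; [exact: HG|exact: HG|exact: st|rewrite sn].
  have [V [oV Vw VW]] := compact_hausdorff_regular cT hT oW Ww.
  have VW' : V `<=` W by apply: subset_trans VW; exact: subset_closure.
  exists V; split; split=> //.
  - by exists w.
  - by move=> t /VW' /WH /HG.
  - by move=> t /VW /WH.
  - by move=> t /VW' /Wn.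
have [u [_ uP]] := dependent_choice_inv okG stepP.
have [p pP] : exists p, forall n, closure (u n) p.
  apply: compact_nested => // n.
  - exact: closed_closure.
  - have [[_ [t ut] _] _] := uP n; exists t; exact: subset_closure.
  - have [_ [un _]] := uP n; apply: subset_trans un _; exact: subset_closure.
have [_ [u2 _]] := uP (code p).+1; have [_ [_ u1]] := uP (code p).
exact: (u1 p) (u2 _ (pP _)) _.
Qed.

Lemma third_index (a b : 'I_3) : exists i : 'I_3, i != a /\ i != b.
Proof.
have : (0 < #|~: [set a; b]%SET|)%N.
  by rewrite cardsCs finset.setCK card_ord cards2 subn_gt0; case: (a != b).
by move=> /card_gt0P[i]; rewrite !inE negb_or => /andP[]; exists i.
Qed.

(** Two points [x <> y] with branches [N] and [M] get the same code: a basic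
    neighbourhood [b m] of both, and for every [i] a finite union of basic sets
    inside [N i], respectively [M i], that covers the trace of that branch on
    the boundary of [b m].  So [N i] and [M i] agree on this boundary.  Among
    three indices one, [i], is such that [y] is not in [N i] and [x] is not in
    [M i].  Then [N i `\` M i], within the closure of [b m], does not meet the
    boundary of [b m], and its own boundary is contained in [[set x]]. *)
Lemma exists_leaf (T : topologicalType) (b : nat -> set T) (G : set T) :
  compact [set: T] -> hausdorff_space T -> countable_base b ->
  (forall x : T, ~ open [set x]) ->
  (forall x : T, exists N : 'I_3 -> set T, splits x N) ->
  open G -> G !=set0 ->
  exists E x, [/\ open E, E !=set0, ~ E x, closed (E `|` [set x]) &
                  E `|` [set x] `<=` G].
Proof.
move=> cT hT bb noiso spl oG G0; have [ob nb] := bb.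
pose data (x : T) (c : nat * {ffun 'I_3 -> seq nat}) (N : 'I_3 -> set T) :=
  [/\ splits x N, b c.1 x, closure (b c.1) `<=` G,
      closure (b c.1) `<=` [set x] `|` \bigcup_i N i &
      forall i, (forall m, m \in c.2 i -> b m `<=` N i) /\
        forall t, N i t -> closure (b c.1) t -> ~ b c.1 t ->
          exists2 m, m \in c.2 i & b m t].
have /choice[code codeP] : forall x, exists c, G x -> exists N, data x c N.
  move=> x; have [Gx|nGx] := pselect (G x); last by exists (0%N, [ffun=> [::]]).
  have [N sN] := spl x; have [oN dN Nx clN oxN] := sN.
  have [V [oV Vx VW]] := compact_hausdorff_regular cT hT (openI oG oxN)
    (conj Gx (or_introl (erefl x))).
  have [m [bm bV]] := nb _ _ (open_nbhs_nbhs (conj oV Vx)).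
  have clb : closure (b m) `<=` G `&` ([set x] `|` \bigcup_i N i).
    by apply: subset_trans VW; exact: closureS.
  have /choice[s sP] : forall i, exists s : seq nat,
      (forall m, m \in s -> b m `<=` N i) /\
      forall t, N i t -> closure (b m) t -> ~ b m t ->
          exists2 m, m \in s & b m t.
    move=> i.
    have cK : compact (closure (b m) `&` ~` b m `&`
        ~` \bigcup_(j in [set j | j != i]) N j).
      apply: (@subclosed_compact _ _ [set: T]) => //.
      apply: closedI; first apply: closedI.
      - exact: closed_closure.
      - exact: open_closedC.
      - by apply: open_closedC; apply: bigcup_open => j _; exact: oN.
    have [|s [sN' sK]] := compact_basic_cover bb cK (oN i).
      move=> t [[/clb[_ [->//|[j _ Nj]]] nbt] nt].
      have [<- //|ji] := eqVneq j i.
      by exfalso; apply: nt; exists j.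
    exists s; split=> // t Nt ct nbt; apply: sK; split=> // -[j /= ji Nj].
    by move: ji; rewrite (dN _ _ _ Nj Nt) eqxx.
  exists (m, [ffun i => s i]) => _; exists N; split=> //=.
  - by move=> t /clb[].
  - by move=> t /clb[].
  - by move=> i; rewrite ffunE; exact: sP.
have [x [y [Gx Gy xy]]] :=
  exists_same_code (fun x => pickle (code x)) cT hT noiso oG G0.
move=> /(pcan_inj pickleK) cxy.
have [N [[oN dN Nx clN _] bx clG clxN NP]] := codeP x Gx.
have [M [[oM dM My clM _] by_ _ clyM MP]] := codeP y Gy.
rewrite -cxy in by_ clyM MP.
move: (code x) => [m c] /= in bx clG clxN NP by_ clyM MP.
have bcl : b m `<=` closure (b m) by exact: subset_closure.
have [a Na] : exists a, N a y.
  by have [yx|[a _ Na]] := clxN _ (bcl _ by_); [case: xy | exists a].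
have [a' Ma] : exists a', M a' x.
  by have [xy'|[a' _ Ma]] := clyM _ (bcl _ bx); [case: xy | exists a'].
have [i [ia ia']] := third_index a a'.
have nNy : ~ N i y by move=> Ni; move: ia; rewrite (dN _ _ _ Ni Na) eqxx.
have nMx : ~ M i x by move=> Mi; move: ia'; rewrite (dM _ _ _ Mi Ma) eqxx.
pose oth (L : 'I_3 -> set T) := \bigcup_(j in [set j | j != i]) L j.
have ooth L : (forall j, open (L j)) -> open (oth L).
  by move=> oL; apply: bigcup_open => j _.
(* Inside the closure of [b m], the complement of [M i] is, except for [y], the
   union of the other branches; this makes [E] open. *)
have nMoth t : closure (b m) t -> t <> y -> ~ M i t -> oth M t.
  move=> /clyM[->//|[j _ Mj]] ty nMi; exists j => //=; apply/eqP => ji.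
  by apply: nMi; rewrite -ji.
pose E := N i `&` b m `&` oth M.
have NME t : N i t -> closure (b m) t -> ~ M i t -> E t.
  move=> Nt ct nMt; split; last first.
    by apply: nMoth => // ty; apply: nNy; rewrite -ty.
  split=> //; apply: contrapT => nbt.
  have [_ /(_ t Nt ct nbt)[k kc bk]] := NP i.
  by have [/(_ k kc t bk)] := MP i.
have EM t : oth M t -> ~ M i t.
  by move=> [j /= ji Mj] Mi; move: ji; rewrite (dM _ _ _ Mj Mi) eqxx.
have Ex : E `|` [set x] = closure (b m) `&` ~` oth N `&` ~` M i.
  apply/seteqP; split=> [t [[[Nt bt] /EM nMt]|->]|t [[ct nt] nMt]].
  - split=> //; split; first exact: bcl.
    by move=> [j /= ji Nj]; move: ji; rewrite (dN _ _ _ Nj Nt) eqxx.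
  - split=> //; split; first exact: bcl.
    by move=> [j _ /Nx].
  - have [->|[j _ Nj]] := clxN _ ct; first by right.
    have [ji|ji] := eqVneq j i; last by exfalso; apply: nt; exists j.
    by left; apply: NME => //; rewrite -ji.
exists E, x; split.
- by apply: openI; [apply: openI; [exact: oN|exact: ob] | exact: ooth].
- have [|t [Nt [bt nt]]] := clN i (b m `&` ~` (closure (b m) `&` ~` oth M)).
    apply: open_nbhs_nbhs; split.
      apply: openI => //; apply: closed_openC; apply: closedI.
        exact: closed_closure.
      by apply: open_closedC; exact: ooth.
    by split=> // -[_]; apply; apply: nMoth => //; exact: bcl.
  exists t; split=> //; apply: contrapT => no; apply: nt; split=> //.
  exact: bcl.
- by move=> [[/Nx]].
- rewrite Ex; apply: closedI; first apply: closedI.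
  + exact: closed_closure.
  + by apply: open_closedC; exact: ooth.
  + by apply: open_closedC; exact: oM.
- by move=> t; rewrite Ex => -[[/clG]].
Qed.

(** Let leaves [E n], with vertices [x n], shrink to [p].  Choose a branch
    [N j] at [p] that misses [x n] for infinitely many [n]; two of the three
    branches cannot both contain almost all vertices.  If [k < m] are two such
    indices, with [k] large, then [E k `&` N j `\` E m] is clopen, because its
    only possible boundary points are [x k], [p] and [x m], and the first and
    the last are not adherent to [N j] while [p] is interior to [E m].  For
    large [m] it is not empty, since [N j] accumulates at [p]. *)
Lemma exists_clopen_sub (T : topologicalType) (small : nat -> set T -> Prop)
    (G : set T) :
  compact [set: T] -> hausdorff_space T -> development small ->
  (forall x : T, ~ open [set x]) ->
  (forall x : T, exists N : 'I_3 -> set T, splits x N) ->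
  open G -> G !=set0 -> exists K, [/\ clopen K, K !=set0 & K `<=` G].
Proof.
move=> cT hT dev noiso spl oG G0; apply: contrapT => noclopen.
have [b bb] := compact_countable_base cT dev.
have [dex dsub dle dnbhs] := dev.
pose leafclos (s : set T * T) := s.1 `|` [set s.2].
pose ok (s : set T * T) := [/\ open s.1, s.1 !=set0, ~ s.1 s.2,
  closed (leafclos s) & leafclos s `<=` G].
pose step n (s s' : set T * T) :=
  leafclos s' `<=` s.1 /\ small n (leafclos s').
have leafP (W : set T) : open W -> W !=set0 -> W `<=` G ->
    exists s, ok s /\ leafclos s `<=` W.
  move=> oW W0 WG.
  have [E [x [oE E0 Ex cE EW]]] := exists_leaf cT hT bb noiso spl oW W0.
  by exists (E, x); split=> //; split=> //; apply: subset_trans EW WG.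
have [s0 [ok0 _]] := leafP G oG G0 (fun t Gt => Gt).
have stepP n s : ok s -> exists s', ok s' /\ step n s s'.
  move=> [os [t st] _ _ sG]; have [U [oU Ut sU]] := dex n t.
  have [|||s' [oks' s'P]] := leafP (s.1 `&` U).
  - exact: openI.
  - by exists t.
  - by move=> r [sr _]; apply: sG; left.
  exists s'; split=> //; split; first by move=> r /s'P[].
  by apply: dsub sU _ => r /s'P[].
have [u [_ uP]] := dependent_choice_inv ok0 stepP.
pose D n := leafclos (u n); pose E n := (u n).1; pose x n := (u n).2.
have okE n : ok (u n) by have [] := uP n.
have oE n : open (E n) by have [] := okE n.
have cD n : closed (D n) by have [] := okE n.
have xE n : ~ E n (x n) by have [] := okE n.
have DE n : D n.+1 `<=` E n by have [_ []] := uP n.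
have ED n : E n `<=` D n by move=> t Et; left.
have DS n : D n.+1 `<=` D n by move=> t /DE /ED.
have sD n : small n (D n.+1) by have [_ []] := uP n.
have [p Dp] : exists p, forall n, D n p.
  apply: compact_nested => // n; by exists (x n); right.
have Ep n : E n p by apply: DE; exact: Dp.
have Dsmall (U : set T) : nbhs p U -> exists n, D n `<=` U.
  by move=> /dnbhs[n nU]; exists n.+1; apply: nU.
have Dp1 t : t <> p -> exists n, ~ D n t.
  move=> /nesym pt; have [U [V [oU _ Up Vt UV]]] := hausdorff_sep hT pt.
  have [n nU] := Dsmall U (open_nbhs_nbhs (conj oU Up)).
  by exists n => /nU Ut; exact: UV Vt.
have [N [oN dN Np clN opN]] := spl p.
have [j often] : exists j, forall n, exists2 k, (n <= k)%N & ~ N j (x k).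
  have [?|/existsNP[n0 n0P]] := pselect (forall n, exists2 k,
    (n <= k)%N & ~ N ord0 (x k)); first by exists ord0.
  exists ord_max => n; exists (maxn n n0); first exact: leq_maxl.
  move=> Nmax; apply: n0P; exists (maxn n n0); first exact: leq_maxr.
  by move=> N0; have := dN _ _ _ Nmax N0.
have [M0 M0P] := Dsmall _ (open_nbhs_nbhs (conj opN (or_introl (erefl p)))).
have [k M0k nNk] := often M0.
have DkO : D k `<=` [set p] `|` \bigcup_i N i.
  by apply: subset_trans M0P; exact: nested_le.
have [q [Nq Eq]] := clN j (E k) (open_nbhs_nbhs (conj (oE k) (Ep k))).
have [|M1 nDq] := Dp1 q; first by move=> qp; apply: (Np j); rewrite -qp.
have [m M1m nNm] := often M1.
have nEmq : ~ E m q by move=> /ED Dq; apply: nDq; exact: nested_le Dq.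
pose oth := \bigcup_(i in [set i | i != j]) N i.
have ooth : open oth by apply: bigcup_open => i _.
have nNoth t : N j t -> ~ oth t.
  by move=> Nt [i /= ij Ni]; move: ij; rewrite (dN _ _ _ Ni Nt) eqxx.
pose F := E k `&` N j `&` ~` E m.
have FE1 : F = E k `&` N j `&` ~` D m.
  apply/seteqP; split=> t [[Et Nt] nt]; split=> //.
    by move=> [//|tx]; apply: nNm; rewrite -[x m]tx.
  by move=> /ED.
have FE2 : F = D k `&` ~` oth `&` ~` E m.
  apply/seteqP; split=> [t [[Et Nt] nEt]|t [[Dt nt] nEt]].
    by split=> //; split; [exact: ED | exact: nNoth].
  have Nt : N j t.
    have [tp|[i _ Ni]] := DkO _ Dt; first by case: nEt; rewrite tp.
    have [<- //|ij] := eqVneq i j; by case: nt; exists i.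
  by split=> //; split=> //; case: Dt => // tx; case: nNk; rewrite -[x k]tx.
apply: noclopen; exists F; split.
- split.
    rewrite FE1; apply: openI; first by apply: openI => //; exact: oN.
    exact: closed_openC.
  rewrite FE2; apply: closedI.
    by apply: closedI => //; exact: open_closedC.
  exact: open_closedC.
- by exists q.
- by move=> t [[/ED Dt _] _]; have [_ _ _ _] := okE k; exact.
Qed.

(** * Spaces with homeomorphic cards *)

Lemma hausdorff_inj (T U : topologicalType) (f : T -> U) :
  injective f -> continuous f -> hausdorff_space U -> hausdorff_space T.
Proof.
move=> injf cf hU p q pq; apply/injf/hU => A B fpA fqB.
by have [t [At Bt]] := pq _ _ (cf p _ fpA) (cf q _ fqB); exists (f t).
Qed.

Lemma homeomorphic_hausdorff (T U : topologicalType) :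
  homeomorphic T U -> hausdorff_space U -> hausdorff_space T.
Proof. by move=> [f [g [fK _ cf _]]]; exact: hausdorff_inj (can_inj fK) cf. Qed.

Lemma set_type_hausdorff (T : topologicalType) (A : set T) :
  hausdorff_space T -> hausdorff_space A.
Proof.
apply: (@hausdorff_inj _ _ set_val) => [|a]; first exact: val_inj.
exact: initial_continuous.
Qed.

(** Two points are compared in the card that omits a third one.  This first
    shows that points are closed, after which the cards are open and a
    separation in a card is one in [Z]. *)
Lemma hausdorff_cards (Z : topologicalType) :
  (forall a b : Z, exists c, c <> a /\ c <> b) ->
  (forall z : Z, hausdorff_space (~` [set z] : set Z)) ->
  hausdorff_space Z.
Proof.
move=> third hZ.
have sep (v s t : Z) : v <> s -> v <> t -> s <> t ->
    exists U V : set (~` [set v] : set Z), [/\ open U, open V,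
      (set_val @` U) s, (set_val @` V) t &
      forall r, (set_val @` U) r -> ~ (set_val @` V) r].
  move=> /nesym sv /nesym tv st.
  have Ss : (~` [set v]) s := sv; have St : (~` [set v]) t := tv.
  pose s' : set_type (~` [set v]) := SigSub (mem_set Ss).
  pose t' : set_type (~` [set v]) := SigSub (mem_set St).
  have st' : s' <> t' by move=> /(congr1 set_val).
  have [U [V [oU oV Us Vt UV]]] := hausdorff_sep (hZ v) st'.
  exists U, V; split=> //; [by exists s'|by exists t'|].
  by move=> _ [r Ur <-] [r' Vr /val_inj rr']; rewrite rr' in Vr; exact: (UV r).
have open1 (v : Z) : open (~` [set v]).
  rewrite openE => t tv; have [w [wv wt]] := third v t.
  have [U [V [[U' oU' <-] oV Ut [v' Vv vv'] UV]]] := sep w t v wt wv tv.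
  have Uv : ~ U' v.
    by move=> U'v; apply: (UV v); [exists v'; rewrite //= vv'|exists v'].
  apply: (@filterS _ _ _ U') => [r U'r rv|]; first by apply: Uv; rewrite -rv.
  by apply: open_nbhs_nbhs; split=> //; case: Ut => r /= Ur <-.
rewrite open_hausdorff => s t /eqP st.
have [v [vs vt]] := third s t.
have [U [V [oU oV Us Vt UV]]] := sep v s t vs vt st.
exists (set_val @` U, set_val @` V); first by split; exact/mem_set.
split; [exact: open_set_val|exact: open_set_val|].
by apply/eqP/seteqP; split=> // r [Ur /(UV r Ur)].
Qed.

(** A homeomorphism of the cards at [z] and [x], extended to a bijection of the
    whole spaces. *)
Definition punctured_homeo (Z X : topologicalType) (z : Z) (x : X)
    (f : Z -> X) (g : X -> Z) : Prop :=
  [/\ f z = x, cancel f g, cancel g f,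
      forall t, t <> z -> {for t, continuous f} &
      forall s, s <> x -> {for s, continuous g}].

Lemma punctured_homeo_sym (Z X : topologicalType) (z : Z) (x : X) f g :
  punctured_homeo z x f g -> punctured_homeo x z g f.
Proof. by move=> [fz fK gK cf cg]; split=> //; rewrite -fz fK. Qed.

Lemma homeomorphic_punctured (Z X : topologicalType) (z : Z) (x : X) :
  hausdorff_space Z -> hausdorff_space X ->
  homeomorphic (~` [set z] : set Z) (~` [set x] : set X) ->
  exists f g, punctured_homeo z x f g.
Proof.
move=> hZ hX h.
have [f [g [[fA gB cf cg] fz gx]]] :=
  homeomorphic_homeo_on z x (open_setC1 z hZ) (open_setC1 x hX) h.
exists f, g; split=> //.
- by apply: fz; apply.
- move=> t; have [tz|/fA[]//] := pselect (t = z).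
  by rewrite tz fz ?gx //; apply.
- move=> t; have [tx|/gB[]//] := pselect (t = x).
  by rewrite tx gx ?fz //; apply.
Qed.

Section punctured.
Variables (Z X : topologicalType) (z : Z) (x : X) (f : Z -> X) (g : X -> Z).
Hypotheses (hX : hausdorff_space X) (fg : punctured_homeo z x f g).

Lemma punctured_open (A : set Z) : open A -> ~ A z -> open (g @^-1` A).
Proof.
move=> oA nAz; have [fz fK gK cf cg] := fg.
have -> : g @^-1` A = ~` [set x] `&` g @^-1` A.
  apply/seteqP; split=> t //=; last by case.
  by move=> Ag; split=> // tx; apply: nAz; rewrite -[z]fK fz -tx.
by apply: open_preimage_on => //; exact: open_setC1.
Qed.

Lemma punctured_compact (K : set Z) :
  compact K -> ~ K z -> compact (g @^-1` K).
Proof.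
move=> cK nKz; have [fz fK gK cf cg] := fg.
have -> : g @^-1` K = f @` K.
  apply/seteqP; split=> [t Kg|_ [t Kt <-]]; last by rewrite /= fK.
  by exists (g t).
apply: continuous_compact => //.
apply: continuous_in_subspaceT => t /set_mem Kt.
by apply: cf => tz; apply: nKz; rewrite -tz.
Qed.

Lemma punctured_homeo_sets (A : set Z) : ~ A z -> homeo_sets A (g @^-1` A).
Proof.
move=> nAz; have [fz fK gK cf cg] := fg.
exists f, g; split=> //.
- by move=> t At; rewrite /= fK.
- by move=> t At; apply: cf => tz; apply: nAz; rewrite -tz.
- by move=> t /= At; apply: cg => tx; apply: nAz; rewrite -[z]fK fz -tx.
Qed.

Lemma punctured_gx : g x = z.
Proof. by have [<- fK _ _ _] := fg. Qed.

End punctured.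

Section compact_card.
Variables (Z X : topologicalType) (z : Z) (x : X) (f : Z -> X) (g : X -> Z).
Hypotheses (hZ : hausdorff_space Z) (fg : punctured_homeo z x f g).
Hypothesis cX : compact [set: X].

Let gf := punctured_homeo_sym fg.

Lemma punctured_compactC (W : set X) :
  open W -> W x -> compact (f @^-1` (~` W)) /\ ~ (f @^-1` (~` W)) z.
Proof.
move=> oW Wx; have [fz fK gK cf cg] := fg; split; last by rewrite /= fz.
apply: (punctured_compact gf); last by apply.
by apply: (@subclosed_compact _ _ [set: X]) => //; exact: open_closedC.
Qed.

(** Neighbourhoods of [x] are complements of compact sets that miss [x]. *)
Lemma punctured_cvg : {for z, continuous f}.
Proof.
have [fz fK gK cf cg] := fg.
move=> U; rewrite /= fz nbhsE => -[W [oW Wx] WU].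
have [cK nKz] := punctured_compactC oW Wx.
rewrite nbhsE; exists (~` (f @^-1` (~` W))).
  by split=> //; apply: closed_openC; exact: compact_closed.
by move=> t; rewrite /= notK => /WU.
Qed.

(** Dually, the sets adherent to [x] are those not contained in a compact
    subset of [Z] that misses [z]. *)
Lemma punctured_closure (A : set Z) :
  (forall K, compact K -> ~ K z -> exists t, A t /\ ~ K t) ->
  closure (g @^-1` A) x.
Proof.
move=> AK U; rewrite nbhsE => -[W [oW Wx] WU].
have [fz fK gK cf cg] := fg.
have [cK nKz] := punctured_compactC oW Wx.
have [t [At /contrapT Wt]] := AK _ cK nKz.
by exists (f t); split; [rewrite /= fK|exact: WU].
Qed.

End compact_card.

(** A compact Hausdorff space is the one-point compactification of any of its
    noncompact cards; when a card is compact the missing point is isolated. *)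
Lemma punctured_compact_homeomorphic (Z X : topologicalType) (z : Z) (x : X)
    f g :
  hausdorff_space Z -> hausdorff_space X -> compact [set: Z] ->
  compact [set: X] -> punctured_homeo z x f g -> homeomorphic Z X.
Proof.
move=> hZ hX cZ cX fg; have [fz fK gK cf cg] := fg.
exists f, g; split=> // t.
  have [->|/cf//] := pselect (t = z); exact: (punctured_cvg hZ fg cX).
have [->|/cg//] := pselect (t = x).
exact: (punctured_cvg hX (punctured_homeo_sym fg) cZ).
Qed.

(** * Multiplying branches *)

Definition locally_compact_at (Z : topologicalType) (z : Z) : Prop :=
  forall O : set Z, open O -> O z ->
    exists C V, [/\ compact C, open V, V z, V `<=` C & C `<=` O].

Lemma punctured_locally_compact (Z X : topologicalType) (w : Z) (x : X) f g
    (t : Z) :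
  hausdorff_space Z -> hausdorff_space X -> compact [set: X] ->
  punctured_homeo w x f g -> t <> w -> locally_compact_at t.
Proof.
move=> hZ hX cX fg tw O oO Ot; have [fw fK gK cf cg] := fg.
have gf := punctured_homeo_sym fg; have gx := punctured_gx fg.
have oW : open (g @^-1` (O `\ w)).
  apply: (punctured_open hX fg); last by move=> [_]; apply.
  by apply: openI => //; exact: open_setC1.
have Wft : (g @^-1` (O `\ w)) (f t) by rewrite /= fK.
have [V [oV Vft VW]] := compact_hausdorff_regular cX hX oW Wft.
have nVx : ~ closure V x by move=> /VW[_]; rewrite gx; apply.
have VV : V `<=` closure V by exact: subset_closure.
exists (f @^-1` closure V), (f @^-1` V); split=> //.
- apply: (punctured_compact gf) nVx.
  by apply: (@subclosed_compact _ _ [set: X]) => //; exact: closed_closure.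
- by apply: (punctured_open hZ gf oV) => /VV.
- by move=> s /VV.
- by move=> s /VW[]; rewrite /= fK.
Qed.

(** The branches at [x] are those at [z], cut down to an open set [V] inside a
    compact neighbourhood [C] of [z], and one more: the complement of [C],
    which accumulates at [x] because [Z] is not compact.  Only the compact set
    [C `\` V] is left out. *)
Lemma splits_card (Z X : topologicalType) (z : Z) (x : X) f g n
    (N : 'I_n -> set Z) :
  hausdorff_space Z -> hausdorff_space X -> compact [set: X] ->
  ~ compact [set: Z] -> locally_compact_at z -> punctured_homeo z x f g ->
  splits z N -> exists N' : 'I_n.+1 -> set X, splits x N'.
Proof.
move=> hZ hX cX ncZ lcz fg [oN dN Nz clN opN].
have [fz fK gK cf cg] := fg; have gx := punctured_gx fg.
have [C [V [cC oV Vz VC CO]]] := lcz _ opN (or_introl (erefl z)).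
have Cz := VC _ Vz.
pose L (i : 'I_n.+1) : set Z :=
  if unlift ord_max i is Some j then N j `&` V else ~` C.
have oL i : open (L i).
  rewrite /L; case: unliftP => [j _|_]; first by apply: openI => //; exact: oN.
  by apply: closed_openC; exact: compact_closed.
have Lz i : ~ L i z by rewrite /L; case: unliftP => [j _ [/Nz]|_].
exists (fun i => g @^-1` L i); split.
- by move=> i; exact: (punctured_open hX fg (oL i) (Lz i)).
- move=> i j t; rewrite /L /=.
  case: unliftP => [i' ->|->]; case: unliftP => [j' ->|->] //.
  + by move=> [Ni _] [Nj _]; rewrite (dN _ _ _ Ni Nj).
  + by move=> [_ /VC].
  + by move=> nC [_ /VC].
- by move=> i; rewrite /= gx; exact: Lz.
- move=> i; apply: (punctured_closure fg cX) => K cK nKz.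
  rewrite /L; case: unliftP => [j _|_].
    have oKz : open (V `&` ~` K).
      by apply: openI => //; apply: closed_openC; exact: compact_closed.
    have [t [Nt [Vt Kt]]] := clN j _ (open_nbhs_nbhs (conj oKz (conj Vz nKz))).
    by exists t.
  apply: contrapT => no; apply: ncZ.
  suff <- : C `|` K = [set: Z] by exact: compactU.
  apply/seteqP; split=> // t _; apply: contrapT => /not_orP[nCt nKt].
  by apply: no; exists t.
- have cD : compact (g @^-1` (C `&` ~` V)).
    apply: (punctured_compact fg); last by move=> [_]; apply.
    by apply: compact_closedI => //; exact: open_closedC.
  suff -> : [set x] `|` \bigcup_i g @^-1` L i = ~` (g @^-1` (C `&` ~` V)).
    by apply: closed_openC; exact: compact_closed.
  apply/seteqP; split=> [t [->|[i _]]|t /not_andP nt].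
  + by rewrite /= gx => -[_]; apply.
  + rewrite /L /=; case: unliftP => [j _ [_ Vt] [_]|_ nC [Ct]]; first by apply.
    by move=> _; exact: nC.
  + have [->|tx] := pselect (t = x); first by left.
    right; have [Ct|nCt] := pselect (C (g t)); last first.
      by exists ord_max => //=; rewrite /L unlift_none.
    have Vt : V (g t) by case: nt => // /contrapT.
    have [gtz|[j _ Nj]] := CO _ Ct; first by case: tx; rewrite -[t]gK gtz fz.
    by exists (lift ord_max j) => //=; rewrite /L liftK.
Qed.

(** Having branches is local, and every point of [Z] lies in some card. *)
Lemma splits_back (Z X : topologicalType) (w z : Z) (x : X) f g n
    (N : 'I_n -> set X) :
  hausdorff_space Z -> hausdorff_space X -> punctured_homeo w x f g ->
  z <> w -> splits (f z) N -> exists N' : 'I_n -> set Z, splits z N'.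
Proof.
move=> hZ hX fg zw [oN dN Nz clN opN].
have [fw fK gK cf cg] := fg; have gx := punctured_gx fg.
have gf := punctured_homeo_sym fg.
have fzx : f z <> x by rewrite -fw => /(can_inj fK).
exists (fun i => f @^-1` (N i `\ x)); split.
- move=> i; apply: (punctured_open hZ gf); last by move=> [_]; apply.
  by apply: openI => //; exact: open_setC1.
- by move=> i j t [Ni _] [Nj _]; exact: dN Ni Nj.
- by move=> i [/Nz].
- move=> i U; rewrite nbhsE => -[W [oW Wz] WU].
  have oW' : open (g @^-1` (W `\ w)).
    apply: (punctured_open hX fg); last by move=> [_]; apply.
    by apply: openI => //; exact: open_setC1.
  have Wfz : (g @^-1` (W `\ w)) (f z) by rewrite /= fK.
  have [t [Nt [Wt tw]]] := clN i _ (open_nbhs_nbhs (conj oW' Wfz)).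
  exists (g t); split; last exact: WU.
  by rewrite /= gK; split=> // tx; apply: tw; rewrite tx.
- suff -> : [set z] `|` \bigcup_i f @^-1` (N i `\ x) =
      f @^-1` (([set f z] `|` \bigcup_i N i) `\ x).
    apply: (punctured_open hZ gf); last by move=> [_]; apply.
    by apply: openI => //; exact: open_setC1.
  apply/seteqP; split.
    move=> t [->|[i _ [Ni tx]]]; first by split=> //; left.
    by split=> //; right; exists i.
  move=> t [[/(can_inj fK) ->|[i _ Ni]] tx]; first by left.
  by right; exists i.
Qed.

Lemma nonisolated_splits (T : topologicalType) (x : T) :
  hausdorff_space T -> ~ open [set x] ->
  exists N : 'I_1 -> set T, splits x N.
Proof.
move=> hT niso; exists (fun=> ~` [set x]); split.
- by move=> _; exact: open_setC1.
- by move=> i j t _ _; rewrite !ord1.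
- by move=> _; apply.
- move=> _ U; rewrite nbhsE => -[W [oW Wx] WU]; apply: contrapT => no.
  apply: niso; suff <- : W = [set x] by [].
  apply/seteqP; split=> [t Wt|t ->//]; apply: contrapT => tx; apply: no.
  by exists t; split=> //; exact: WU.
- suff -> : [set x] `|` \bigcup_(i : 'I_1) ~` [set x] = [set: T].
    exact: openT.
  apply/seteqP; split=> // t _; have [->|tx] := pselect (t = x); first by left.
  by right; exists ord0.
Qed.

(** * Sequences escaping to infinity *)

(** Convergence to the point at infinity of [Z]. *)
Definition escapes (Z : topologicalType) (L : nat -> set Z) : Prop :=
  forall D, compact D -> exists N, forall n, (N <= n)%N ->
    forall t, L n t -> ~ D t.

(** Approaching [x] inside the complement of a compact neighbourhood [C] of
    [z] means, in [Z], going to infinity.  The sets are chosen in [X], where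
    [x] has a countable base of neighbourhoods.  The predicate [Q] allows
    further requirements on them. *)
Lemma exists_escaping (Z X : topologicalType) (z : Z) (x : X) f g
    (small : nat -> set X -> Prop) (Q : set X -> Prop) :
  hausdorff_space Z -> hausdorff_space X -> compact [set: X] ->
  development small -> ~ compact [set: Z] -> locally_compact_at z ->
  punctured_homeo z x f g ->
  (forall G, open G -> G !=set0 ->
     exists K, [/\ clopen K, K !=set0, Q K & K `<=` G]) ->
  exists K : nat -> set X,
    [/\ forall n, [/\ clopen (K n), K n !=set0, Q (K n) & ~ K n x],
        forall i j t, K i t -> K j t -> i = j &
        escapes (fun n => f @^-1` K n)].
Proof.
move=> hZ hX cX [dex dsub dle dnbhs] ncZ lcz fg GQ.
have [fz fK gK cf cg] := fg; have gx := punctured_gx fg.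
have [C [V [cC oV Vz VC _]]] := lcz _ openT I.
have Cz := VC _ Vz.
have oC : open (g @^-1` (~` C)).
  apply: (punctured_open hX fg); last by apply.
  by apply: closed_openC; exact: compact_closed.
have clC : closure (g @^-1` (~` C)) x.
  apply: (punctured_closure fg cX) => D cD nDz; apply: contrapT => no.
  apply: ncZ; suff <- : C `|` D = [set: Z] by exact: compactU.
  apply/seteqP; split=> // t _; apply: contrapT => /not_orP[nCt nDt].
  by apply: no; exists t.
(* A state is a pair [(W, K)]: the set [K] just chosen, and a neighbourhood [W]
   of [x] that avoids it and contains all later choices. *)
pose ok (s : set X * set X) := [/\ open s.1, s.1 x,
  [/\ clopen s.2, s.2 !=set0, Q s.2 & ~ s.2 x], s.2 `<=` g @^-1` (~` C) &
  forall t, s.1 t -> ~ s.2 t].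
pose step n (s s' : set X * set X) :=
  [/\ s'.1 `<=` s.1, s'.2 `<=` s.1 & small n s'.1].
have next n (W : set X) : open W -> W x ->
    exists s', ok s' /\ [/\ s'.1 `<=` W, s'.2 `<=` W & small n s'.1].
  move=> oW Wx; have [||K [[oK cK] K0 QK KG]] := GQ (W `&` g @^-1` (~` C)).
  - exact: openI.
  - by have [t [Ct Wt]] := clC _ (open_nbhs_nbhs (conj oW Wx)); exists t.
  have nKx : ~ K x by move=> /KG[_]; rewrite /= gx; apply.
  have [U [oU Ux sU]] := dex n x.
  exists ((W `&` U) `\` K, K); split; last first.
    split=> [t [[]]|t /KG[]|] //=.
    by apply: dsub sU _ => t [[]].
  split=> //=.
  - by apply: openI; [exact: openI | exact: closed_openC].
  - by move=> t /KG[].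
  - by move=> t [].
have [s0 [ok0 _]] := next 0%N _ openT I.
have stepP n s : ok s -> exists s', ok s' /\ step n s s'.
  by move=> [os sx _ _ _]; exact: next.
have [u [_ uP]] := dependent_choice_inv ok0 stepP.
pose W n := (u n).1; pose K n := (u n).2.
have WS n : W n.+1 `<=` W n by have [_ []] := uP n.
have KW n : K n.+1 `<=` W n by have [_ []] := uP n.
have KW_lt i j : (i < j)%N -> K j `<=` W i.
  by case: j => // j; rewrite ltnS => ij t /KW; exact: nested_le.
have dW n t : W n t -> ~ K n t by have [[_ _ _ _ +] _] := uP n; exact.
exists K; split.
- by move=> n; have [[]] := uP n.
- move=> i j t Ki Kj; have [ij|ji|//] := ltngtP i j.
  + by have := dW _ _ (KW_lt _ _ ij _ Kj).
  + by have := dW _ _ (KW_lt _ _ ji _ Ki).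
- move=> D cD.
  have cDV : compact (g @^-1` (D `&` ~` V)).
    apply: (punctured_compact fg); last by move=> [_]; apply.
    by apply: compact_closedI => //; exact: open_closedC.
  have oDV : open (~` (g @^-1` (D `&` ~` V))).
    by apply: closed_openC; exact: compact_closed.
  have [|n nU] := dnbhs x _ (open_nbhs_nbhs (conj oDV _)).
    by rewrite /= gx => -[_]; apply.
  exists n.+2 => m nm t Kt Dt.
  have Wx : W n.+1 x by have [[]] := uP n.+1.
  have sW : small n (W n.+1) by have [_ []] := uP n.
  apply: (nU _ sW Wx _ (KW_lt _ _ nm _ Kt)); rewrite /= fK; split=> //.
  have [[_ _ _ /(_ _ Kt) /= nC _] _] := uP m.
  by move=> /VC; rewrite -[t]fK.
Qed.

Lemma escapes_sub (Z : topologicalType) (L L' : nat -> set Z) :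
  escapes L -> (forall n, L' n `<=` L n) -> escapes L'.
Proof.
by move=> eL L'L D /eL[N NP]; exists N => n Nn t /L'L; exact: NP.
Qed.

Lemma escapes_point (Z : topologicalType) (L : nat -> set Z) (z : Z) :
  escapes L -> exists N, forall n, (N <= n)%N -> ~ L n z.
Proof.
move=> /(_ _ (@compact_set1 _ z))[N NP]; exists N => n Nn Lz; exact: NP Lz _.
Qed.

Lemma escapes_converge (Z X : topologicalType) (z : Z) (x : X) f g
    (L : nat -> set Z) :
  hausdorff_space Z -> hausdorff_space X -> compact [set: X] ->
  punctured_homeo z x f g -> escapes L ->
  sets_converge (fun n => g @^-1` L n) x.
Proof.
move=> hZ hX cX fg eL U; rewrite nbhsE => -[W [oW Wx] WU].
have [fz fK gK cf cg] := fg.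
have [cK _] := punctured_compactC fg cX oW Wx.
have [N NP] := eL _ cK.
exists N => // n Nn t Lt; apply: WU; apply: contrapT => nW.
by apply: NP Nn _ Lt _; rewrite /= gK.
Qed.

Lemma punctured_clopen (Z X : topologicalType) (z : Z) (x : X) f g (A : set Z) :
  hausdorff_space X -> punctured_homeo z x f g ->
  open A -> compact A -> ~ A z -> clopen (g @^-1` A).
Proof.
move=> hX fg oA cA nAz; split; first exact: (punctured_open hX fg oA nAz).
by apply: compact_closed => //; exact: (punctured_compact fg cA nAz).
Qed.

Definition twins (T : topologicalType) (K1 K2 : set T) : Prop :=
  [/\ clopen K1 /\ clopen K2, K1 !=set0 /\ K2 !=set0, homeo_sets K1 K2 &
      forall t, K1 t -> ~ K2 t].

(** Clopen sets leaving every compact subset of [Z] are chosen twice.  The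
    first sequence only serves to show that every nonempty open subset of [X]
    contains twins: near two distinct points of it appear clopen copies of the
    same member of the sequence.  The second sequence consists of twins. *)
Lemma not_reconstructible_universal (X : topologicalType)
    (small : nat -> set X -> Prop) :
  compact [set: X] -> hausdorff_space X -> development small ->
  [set: X] !=set0 -> (forall a b : X, exists c, c <> a /\ c <> b) ->
  forall Z : topologicalType, deck Z = deck X -> ~ homeomorphic Z X ->
  has_universal_sequence X.
Proof.
move=> cX hX dev [x0 _] thirdX Z dZX nZX.
have ZtoX (z : Z) : exists x : X,
    homeomorphic (~` [set z] : set Z) (~` [set x] : set X).
  have : deck Z (homeo_class (~` [set z] : set Z)) by exists z.
  rewrite dZX => -[x e]; exists x.
  by rewrite -/(homeo_class _ _) e; exact: homeomorphic_refl.
have XtoZ (x : X) : exists z : Z,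
    homeomorphic (~` [set z] : set Z) (~` [set x] : set X).
  have : deck X (homeo_class (~` [set x] : set X)) by exists x.
  rewrite -dZX => -[z e]; exists z; apply: homeomorphic_sym.
  by rewrite -/(homeo_class _ _) e; exact: homeomorphic_refl.
have thirdZ (a b : Z) : exists c, c <> a /\ c <> b.
  have [x [f [g [fK gK _ _]]]] := ZtoX a.
  have [c1 [c1x _]] := thirdX x x; have [c2 [c2x c12]] := thirdX x c1.
  have S1 : (~` [set x]) c1 := c1x; have S2 : (~` [set x]) c2 := c2x.
  pose s1 : set_type (~` [set x]) := SigSub (mem_set S1).
  pose s2 : set_type (~` [set x]) := SigSub (mem_set S2).
  have [e1|?] := pselect (set_val (g s1) = b); last first.
    by exists (set_val (g s1)); split=> //; exact: (set_valP (g s1)).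
  exists (set_val (g s2)); split; first exact: (set_valP (g s2)).
  rewrite -e1 => /val_inj /(can_inj gK) e; apply: c12.
  exact: (congr1 set_val e).
have hZ : hausdorff_space Z.
  apply: hausdorff_cards => // z; have [x zx] := ZtoX z.
  by apply: homeomorphic_hausdorff zx _; exact: set_type_hausdorff.
have ZX z : exists x f g, @punctured_homeo Z X z x f g.
  have [x zx] := ZtoX z; have [f [g fg]] := homeomorphic_punctured hZ hX zx.
  by exists x, f, g.
have XZ x : exists z f g, @punctured_homeo Z X z x f g.
  have [z zx] := XtoZ x; have [f [g fg]] := homeomorphic_punctured hZ hX zx.
  by exists z, f, g.
have ncZ : ~ compact [set: Z].
  move=> cZ; have [z [f [g fg]]] := XZ x0.
  exact/nZX/(punctured_compact_homeomorphic hZ hX cZ cX fg).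
have lcZ (z : Z) : locally_compact_at z.
  have [w [wz _]] := thirdZ z z; have [x [f [g fg]]] := ZX w.
  by apply: (punctured_locally_compact hZ hX cX fg) => /esym.
have nisoX (x : X) : ~ open [set x].
  move=> ox; have [z [f [g fg]]] := XZ x.
  have [cK _] := punctured_compactC fg cX ox (erefl x).
  apply: ncZ; suff <- : [set z] `|` f @^-1` (~` [set x]) = [set: Z].
    by apply: compactU => //; exact: compact_set1.
  have [fz fK _ _ _] := fg.
  apply/seteqP; split=> // t _; have [->|tz] := pselect (t = z); first by left.
  by right=> /= ftx; apply: tz; rewrite -[t]fK ftx -fz fK.
have back n (spX : forall x : X, exists N : 'I_n -> set X, splits x N) (z : Z) :
    exists N : 'I_n -> set Z, splits z N.
  have [w [wz _]] := thirdZ z z; have [x [f [g fg]]] := ZX w.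
  have [N sN] := spX (f z).
  by apply: (splits_back hZ hX fg _ sN) => /esym.
have forth n (spZ : forall z : Z, exists N : 'I_n -> set Z, splits z N)
    (x : X) : exists N : 'I_n.+1 -> set X, splits x N.
  have [z [f [g fg]]] := XZ x; have [N sN] := spZ z.
  exact: (splits_card hZ hX cX ncZ (lcZ z) fg sN).
(* Nonisolated points have one branch; each round through [Z] adds one. *)
have spl3 : forall x : X, exists N : 'I_3 -> set X, splits x N.
  apply/forth/back/forth/back => x; exact: nonisolated_splits.
have dense := exists_clopen_sub cX hX dev nisoX spl3.
have [z0 [f0 [g0 fg0]]] := XZ x0.
have gf0 := punctured_homeo_sym fg0.
have pull (K : set X) : clopen K -> ~ K x0 ->
    [/\ open (f0 @^-1` K), compact (f0 @^-1` K) & homeo_sets K (f0 @^-1` K)].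
  move=> [oK cK] nK; split.
  - exact: (punctured_open hZ gf0 oK nK).
  - apply: (punctured_compact gf0) nK.
    exact: (@subclosed_compact _ _ [set: X]).
  - exact: (punctured_homeo_sets gf0).
have twins_in (G : set X) : open G -> G !=set0 ->
    exists K1 K2, twins K1 K2 /\ K1 `|` K2 `<=` G.
  move=> oG [x Gx].
  have [|K [KP _ eK]] :=
      exists_escaping (Q := fun=> True) hZ hX cX dev ncZ (lcZ z0) fg0.
    move=> G' oG' G'0; have [K [? ? ?]] := dense G' oG' G'0; by exists K.
  pose L n := f0 @^-1` K n.
  have near_pt (W : set X) (y : X) : open W -> W y -> exists N, forall n,
      (N <= n)%N -> exists K', [/\ clopen K', K' !=set0, homeo_sets (L n) K' &
        K' `<=` W].
    move=> oW Wy; have [z [f [g fg]]] := XZ y.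
    have [N1 N1P] := escapes_point z eK.
    have [N2 _ N2P] := escapes_converge hZ hX cX fg eK
      (open_nbhs_nbhs (conj oW Wy)).
    exists (maxn N1 N2) => n; rewrite geq_max => /andP[Nn1 Nn2].
    have [cK [t Kt] _ nKx] := KP n; have [oL cL _] := pull _ cK nKx.
    have nLz := N1P _ Nn1; have [fz fK gK _ _] := fg.
    have [fz0 fK0 gK0 _ _] := fg0.
    exists (g @^-1` L n); split.
    - exact: (punctured_clopen hX fg).
    - by exists (f (g0 t)); rewrite /L /= fK gK0.
    - exact: (punctured_homeo_sets fg).
    - exact: N2P.
  have [y [Gy xy]] : exists y, G y /\ x <> y.
    apply: contrapT => no; apply: (nisoX x); suff <- : G = [set x] by [].
    apply/seteqP; split=> [t Gt|t ->//]; apply: contrapT => tx.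
    by apply: no; exists t; split=> // /esym.
  have [U [V [oU oV Ux Vy UV]]] := hausdorff_sep hX xy.
  have [N1 N1P] := near_pt _ x (openI oU oG) (conj Ux Gx).
  have [N2 N2P] := near_pt _ y (openI oV oG) (conj Vy Gy).
  have [K1 [cK1 K10 hK1 K1U]] := N1P _ (leq_maxl N1 N2).
  have [K2 [cK2 K20 hK2 K2V]] := N2P _ (leq_maxr N1 N2).
  exists K1, K2; split; last by move=> t [/K1U[]|/K2V[]].
  split=> //; first exact: homeo_sets_trans (homeo_sets_sym hK1) hK2.
  by move=> t /K1U[Ut _] /K2V[Vt _]; exact: (UV t).
pose Q (K : set X) := exists K1 K2, twins K1 K2 /\ K = K1 `|` K2.
have [|K [KP dK eK]] := exists_escaping (Q := Q) hZ hX cX dev ncZ (lcZ z0) fg0.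
  move=> G oG G0; have [K1 [K2 [tK KG]]] := twins_in G oG G0.
  have [[c1 c2] [n1 _] _ _] := tK.
  exists (K1 `|` K2); split=> //; first exact: clopenU.
    by have [t Kt] := n1; exists t; left.
  by exists K1, K2.
have /choice[K1 /choice[K2 K12]] : forall n, exists K1 K2,
    twins K1 K2 /\ K n = K1 `|` K2.
  by move=> n; have [_ _ + _] := KP n.
(* The choice of [K2 n] over [K1 n] depends on [z], but not its type. *)
pose L (z : Z) n := if pselect ((f0 @^-1` K1 n) z) then f0 @^-1` K2 n
  else f0 @^-1` K1 n.
have LP z n : [/\ open (L z n), compact (L z n), L z n !=set0 &
    [/\ ~ L z n z, homeo_sets (L z n) (K1 n) & L z n `<=` f0 @^-1` K n]].
  have [[[c1 c2] [[t1 Kt1] [t2 Kt2]] h12 d12] KE] := K12 n.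
  have [_ _ _ nKx] := KP n; rewrite KE in nKx.
  have [|o1 k1 h1] := pull _ c1; first by move=> k; apply: nKx; left.
  have [|o2 k2 h2] := pull _ c2; first by move=> k; apply: nKx; right.
  have [_ _ gK0 _ _] := fg0.
  rewrite /L; case: pselect => [K1z|nK1z]; split=> //.
  - by exists (g0 t2); rewrite /= gK0.
  - split; first exact: d12.
      by apply: homeo_sets_sym; exact: homeo_sets_trans h12 h2.
    by move=> t K2t; rewrite /= KE; right.
  - by exists (g0 t1); rewrite /= gK0.
  - by split=> //; [exact: homeo_sets_sym | move=> t K1t; rewrite /= KE; left].
have /choice[zz /choice[ff /choice[gg fgP]]] := XZ.
pose B x n := gg x @^-1` L (zz x) n.
have cB x n : clopen (B x n).
  have [oL cL _ [nL _ _]] := LP (zz x) n.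
  exact: (punctured_clopen hX (fgP x)).
have hB x n : homeo_sets (B x n) (K1 n).
  have [_ _ _ [nL h _]] := LP (zz x) n.
  apply: homeo_sets_trans h; apply: homeo_sets_sym.
  exact: (punctured_homeo_sets (fgP x)).
exists B; split=> [x|x y n]; last first.
  apply/(homeo_setsP x0 x0 (cB _ _).1 (cB _ _).1).
  exact: homeo_sets_trans (hB x n) (homeo_sets_sym (hB y n)).
split=> //.
- move=> i j _ _ [t [Bi Bj]].
  have [_ _ _ [_ _ LKi]] := LP (zz x) i; have [_ _ _ [_ _ LKj]] := LP (zz x) j.
  exact: dK (LKi _ Bi) (LKj _ Bj).
- move=> n; have [_ _ [t Lt] _] := LP (zz x) n.
  have [_ fK _ _ _] := fgP x; by exists (ff x t); rewrite /B /= fK.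
- apply: (escapes_converge hZ hX cX (fgP x)); apply: escapes_sub eK _ => n.
  by have [_ _ _ [_ _ LK]] := LP (zz x) n.
Qed.

(** * The characterisation *)

Lemma one_or_three (T : Type) (t0 : T) :
  ~ ([set: T] #= `I_2)%card ->
  (forall t, t = t0) \/ forall a b : T, exists c, c <> a /\ c <> b.
Proof.
move=> not2; have [one|/existsNP[t1 t10]] := pselect (forall t, t = t0).
  by left.
right=> a b; apply: contrapT => no.
have all2 c : c = a \/ c = b.
  apply: contrapT => /not_orP[ca cb]; apply: no; by exists c.
have ab : a <> b.
  move=> e; apply: t10.
  by have := all2 t1; have := all2 t0; rewrite -e => -[->|->] [->|->].
apply: not2; apply/card_set_bijP.
exists (fun t => if pselect (t = a) then 0%N else 1%N); split.
- by move=> t _ /=; case: pselect.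
- move=> s t _ _; case: pselect => sa; case: pselect => ta //.
    by move=> _; exact: etrans sa (esym ta).
  move=> _; case: (all2 s) => // sb; case: (all2 t) => // tb.
  exact: etrans sb (esym tb).
- case=> [|[|n]] //= _; first by exists a => //; case: pselect.
  by exists b => //; case: pselect => // ba; case: ab.
Qed.

Lemma singleton_reconstructible (X : topologicalType) (x0 : X) :
  (forall x, x = x0) -> reconstructible X.
Proof.
move=> one Z dZX.
have [z0 _] : deck Z (homeo_class (~` [set x0] : set X)).
  by rewrite dZX; exists x0.
have [x] : deck X (homeo_class (~` [set z0] : set Z)).
  by rewrite -dZX; exists z0.
move=> e; have [h _] : homeomorphic (~` [set z0] : set Z) (~` [set x] : set X).
  by rewrite -/(homeo_class _ _) e; exact: homeomorphic_refl.
have oneZ z : z = z0.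
  apply: contrapT => zz0; have Sz : (~` [set z0]) z := zz0.
  apply: (set_valP (h (SigSub (mem_set Sz)))).
  by rewrite /= [LHS]one [RHS]one.
exists (fun=> x0), (fun=> z0); split.
- by move=> z; rewrite (oneZ z).
- by move=> y; rewrite (one y).
- exact: cst_continuous.
- exact: cst_continuous.
Qed.

Theorem theorem1p1 (R : realType) (X : topologicalType)
    (Xcompact : compact [set: X]) (Xmetrizable : metrizable R X)
    (Xnonempty : [set: X] !=set0) (Xnot2 : ~ ([set: X] #= `I_2)%card) :
  reconstructible X <-> ~ has_universal_sequence X.
Proof.
have [hX [small dev]] := metrizable_development Xmetrizable.
split=> [rX uX|nuX].
  exact: universal_not_reconstructible Xcompact hX dev Xnonempty uX rX.
have [x0 _] := Xnonempty.
have [one|third] := one_or_three x0 Xnot2.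
  exact: singleton_reconstructible one.
move=> Z dZX; apply: contrapT => nZX; apply: nuX.
exact: not_reconstructible_universal Xcompact hX dev Xnonempty third Z dZX nZX.
Qed.
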